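(* Let $G$ be a finitely generated metabelian group of Krull dimension $k$, with $k\ge 1$. Assume that the derived subgroup $[G,G]$ is a torsion group. Then $$p_{2n}^G \succsim \exp\left(-n^{\frac{k}{k+2}}\right).$$
   Context: A group is metabelian if its derived subgroup $[G,G]$ is abelian (equivalently, it is an extension of an abelian group by an abelian group). Krull dimension of a group. A poset $A$ is trivial if $a\le b$ implies $a=b$. The deviation $\operatorname{dev} A$, if it exists, is: $-\infty$ if $A$ is empty or trivial; $0$ if $A$ is non-trivial and satisfies the descending chain condition; and inductively $\operatorname{dev} A = n$ (an ordinal) if $\operatorname{dev} A$ is not equal to $m$ for any $m<n$ and in every descending chain $a_1\ge a_2\ge\dots$ of $A$ all but finitely many of the factors $[a_{i+1},a_i]=\{x : a_{i+1}\le x\le a_i\}$ have deviation defined and less than $n$. The Krull dimension $\operatorname{Krull}(G)$ of a group $G$ is the deviation of the poset of normal subgroups of $G$, ordered by inclusion. (It exists and is finite for finitely generated infinite metabelian groups.) Return probability. For a finitely generated group $G$ with a symmetric, finitely supported probability measure $\mu$ whose support generates $G$, $p_{2n}^G=\mu^{(2n)}(e)$, where $\mu^{(m)}$ is the $m$-fold convolution power of $\mu$; up to the equivalence $\sim$ below it does not depend on $\mu$ (one may take $\mu$ uniform on a finite symmetric generating set). Asymptotic comparison. For monotone functions $\varphi,\psi$ write $\varphi\precsim\psi$ if there are positive constants $c,C$ with $c\varphi(Ct)\le\psi(t)$ for all $t$ (for functions of a positive integer variable $n$, $t=n$ ranges over positive integers and $C$ is a positive integer); $\varphi\succsim\psi$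 means $\psi\precsim\varphi$, and $\varphi\sim\psi$ means both. Here $p_{2n}^G$ is regarded as a function of $n$. *)

(* Defs.v *)
From HB Require Import structures.
From mathcomp Require Import all_boot all_order all_algebra.
From mathcomp Require Import all_classical all_reals all_analysis.

Set Implicit Arguments.
Unset Strict Implicit.
Unset Printing Implicit Defensive.

Import Order.TTheory GRing.Theory Num.Theory.

Local Open Scope classical_set_scope.
Local Open Scope ring_scope.

(** Deviation of a poset, given as a subset [A] of a porderType with the
    induced order. *)

Section Deviation.
Context {d : Order.disp_t} {T : porderType d}.
Implicit Types (A : set T) (a : nat -> T).

Definition trivial_poset A : Prop :=
  forall x y, A x -> A y -> (x <= y)%O -> x = y.

Definition descending_chain A a : Prop :=
  (forall i, A (a i)) /\ (forall i, (a i.+1 <= a i)%O).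

Definition chain_factor A a (i : nat) : set T :=
  A `&` [set x | (a i.+1 <= x <= a i)%O].

Definition dcc A : Prop :=
  forall a, descending_chain A a ->
    exists N : nat, forall i : nat, (N <= i)%N -> a i.+1 = a i.

(* "dev A = n", where [Lt B] stands for "dev B is defined and < n"
   (the value -oo being < n). *)
Definition deviation_step (n : nat) (Lt : set T -> Prop) A : Prop :=
  ~ Lt A /\
  (if n is 0 then dcc A
   else forall a, descending_chain A a ->
          finite_set [set i : nat | ~ Lt (chain_factor A a i)]).

(* "dev A is defined and < n"; for n = 0 this says dev A = -oo. *)
Fixpoint deviation_lt (n : nat) A : Prop :=
  if n is m.+1
  then deviation_lt m A \/ deviation_step m (deviation_lt m) A
  else trivial_poset A.

(* "dev A = n" for a finite ordinal n; whether it holds depends only on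
   deviations < n, so infinite ordinals play no role. *)
Definition has_deviation (n : nat) A : Prop :=
  deviation_step n (deviation_lt n) A.

End Deviation.

Section Groups.
Context {G : groupType}.
Implicit Types (H S : set G).

Definition subgroup H : Prop := group_closed (mem H).

Definition normal_subgroup H : Prop :=
  subgroup H /\ forall x g, H x -> H (x ^ g)%g.

Definition generated S : set G := smallest subgroup S.

Definition torsion H : Prop :=
  forall x, H x -> exists2 n : nat, (0 < n)%N & (x ^+ n)%g = 1%g.

End Groups.

Definition finitely_generated (G : groupType) : Prop :=
  exists2 S : set G, finite_set S & generated S = setT.

Definition derived_subgroup (G : groupType) : set G :=
  generated [set [~ x, y]%g | x in setT & y in setT].

Arguments derived_subgroup : clear implicits.

Definition metabelian (G : groupType) : Prop :=
  forall x y, derived_subgroup G x -> derived_subgroup G y -> commute x y.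

(* The order on [set G] is inclusion. *)
Definition has_krull_dim (G : groupType) (k : nat) : Prop :=
  has_deviation k [set N : set G | normal_subgroup N].

Section RandomWalk.
Context {R : realType} {G : groupType}.
Implicit Types (mu nu : G -> R).

(* Measures on the discrete group [G] are given by their point masses. All
   sums over [G] are finite: [\sum_(x \in setT)] sums over the support. *)
Record walk_measure mu : Prop := WalkMeasure {
  walk_ge0 : forall x, 0 <= mu x;
  walk_finite : finite_set [set x | mu x != 0];
  walk_sum1 : \sum_(x \in [set: G]) mu x = 1;
  walk_sym : forall x, mu (x^-1)%g = mu x;
  walk_gen : generated [set x | mu x != 0] = setT }.

Definition convolution mu nu : G -> R :=
  fun x => \sum_(y \in [set: G]) mu y * nu (y^-1 * x)%g.

Definition convolution_pow mu (m : nat) : G -> R :=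
  iter m (convolution mu) (fun x => (x == 1%g)%:R).

Definition return_prob mu (n : nat) : R := convolution_pow mu n.*2 1%g.

End RandomWalk.

(* phi and psi are functions of a positive integer variable. *)
Definition asym_le {R : realType} (phi psi : nat -> R) : Prop :=
  exists (c : R) (C : nat), [/\ 0 < c, (0 < C)%N &
    forall n : nat, (0 < n)%N -> c * phi (C * n)%N <= psi n].

(* Main.v *)
Require Import Defs.
From HB Require Import structures.
From mathcomp Require Import all_boot all_order all_algebra.
From mathcomp Require Import all_field.
From mathcomp Require Import all_classical all_reals all_analysis.
From mathcomp Require Import -(notations) ssrcomplements mpoly.
From mathcomp Require Import ring lra zify.
Import Order.TTheory GRing.Theory Num.Theory.
Set Implicit Arguments.
Unset Strict Implicit.
Unset Printing Implicit Defensive.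
Local Open Scope classical_set_scope.
Local Open Scope ring_scope.

Local Notation ZX d := (mpoly d int).
Local Notation msize p := (mmeasure mdeg p).

(** Why the return probability is this large.

    Let A be the derived subgroup, an abelian torsion group on which G acts by
    conjugation, and let g_1, ..., g_d be the support of the walk. The
    conjugations by the g_i commute on A, so that A is a module over
    Z[x_1, ..., x_d], and its submodules are normal subgroups of G.

    The walk. For a box of side N in Z^d consider the elements
    g_1^e_1 ... g_d^e_d h of G, where e is in the box and h is in the span H of
    the conjugates of the commutators [g_i, g_j] by words of length at most Nd.
    A left multiplication by g_i or its inverse moves e by a unit vector and
    changes h inside H (letter_normal_word), so that a walk whose exponent
    vector stays in the box for time n has not left this finite set S. An
    explicit almost harmonic bump on the box shows that this has probability at
    least (1 - 3/N^2)^n (bump_step, confinement), and Cauchy-Schwarz gives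
    p_2n >= (1 - 3/N^2)^2n / |S| (return_prob_ge). For N of order n^(1/(k+2))
    the theorem follows if |S| <= exp (C N^k), that is, if the balls of a
    finitely generated torsion module whose submodules have deviation at most k
    contain at most exp (C r^k) elements (module_growth).

    The growth of modules. For a generator b of order q and a prime p dividing
    q, the module generated by p b has a generator of smaller order, and it
    remains to study the quotient F_p[x_1, ..., x_d] / I of the module generated
    by b. If every set of k+1 variables satisfies a nonzero relation modulo I,
    then division by the leading monomials of these relations, for a graded
    order, expresses everything of degree at most r by monomials in which at
    most k exponents are large, and there are O(r^k) of these
    (reduced_monomial, card_std_exps).

    The deviation enters through free_mod_lt: a set of variables that is
    algebraically free modulo I has at most k elements. Otherwise take a maximal
    free set with more than k elements, a variable t in it, and the ideals
    generated by I and by Y_i = y_0 ... y_(i-1), where y_i = t^(p^(i+1)) - t. Almost all factors of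
    this chain have deviation less than k, so that by induction f Y_i lies in
    (y_i Y_i) + I for a nonzero polynomial f in the other free variables. By
    maximality the quotient is finite over the free polynomial ring up to
    denominators dividing powers of one polynomial s (finite_over_free), and the
    determinant trick produces a power of s f that y_i divides among polynomials
    in the free variables. But y_i vanishes at every element of the field with
    p^(i+1) elements, and for large i some element is not a root of s. *)

(** * Deviation of posets *)

Section DeviationTransfer.
Context {d d' : Order.disp_t} {T : porderType d} {T' : porderType d'}.

(** The deviation only depends on strict chains, and a strictly increasing map
    turns the chains and factors of its source into chains and factors of its
    target. This is how deviations pass from normal subgroups to submodules and
    from there to ideals. *)
Lemma deviation_lt_homo (f : T -> T') n (A : set T) (B : set T') :
    (forall x, A x -> B (f x)) ->
    (forall x y, A x -> A y -> (x <= y)%O -> (f x <= f y)%O) ->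
    (forall x y, A x -> A y -> (x <= y)%O -> f x = f y -> x = y) ->
  deviation_lt n B -> deviation_lt n A.
Proof.
elim: n A B => [|n IHn] A B fAB f_homo f_inj /=.
  move=> trivB x y Ax Ay xy; apply: f_inj => //.
  by apply: trivB; [exact: fAB|exact: fAB|exact: f_homo].
case=> [ltB|[_ stepB]]; first by left; exact: (IHn _ _ fAB).
have [ltA|nltA] := pselect (deviation_lt n A); [by left|right; split=> //].
have chain_f a : descending_chain A a -> descending_chain B (f \o a).
  by case=> aA a_dec; split=> i /=; [exact: fAB|exact: f_homo].
case: n IHn stepB {nltA} => [_ dccB a aA|n IHn finB a aA].
  have [N stN] := dccB _ (chain_f _ aA).
  exists N => i /stN fai; case: aA => aA a_dec.
  by apply: f_inj.
apply: sub_finite_set (finB _ (chain_f _ aA)) => i; apply: contra_not.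
apply: IHn => [x [Ax /andP[h1 h2]]|x y [Ax _] [Ay _]|x y [Ax _] [Ay _]].
- case: aA => aA a_dec; split; [exact: fAB|apply/andP; split; exact: f_homo].
- exact: f_homo.
- exact: f_inj.
Qed.

End DeviationTransfer.

(** This states the inductive clause of the deviation uniformly: deviation_lt 0
    means that a factor is trivial, as eventually happens under the descending
    chain condition, and if A itself has deviation less than n, then so does every
    subset. *)
Lemma deviation_lt_factor {d : Order.disp_t} {T : porderType d} n
    (A : set T) a : deviation_lt n.+1 A -> descending_chain A a ->
  exists N, forall i, (N <= i)%N -> deviation_lt n (chain_factor A a i).
Proof.
move=> /= devA aA; case: devA => [ltA|[_ stepA]].
  exists 0%N => i _; apply: (@deviation_lt_homo _ _ _ _ id) ltA => //.
  by move=> x [].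
case: n stepA => [dccA|n finA].
  have [N stN] := dccA _ aA; exists N => i /stN ai x y [_ /andP[x1 x2]] [_ /andP[y1 y2]] _.
  rewrite ai in x1 y1.
  have -> : x = a i by apply/le_anti/andP.
  by apply/esym/le_anti/andP.
have /finite_seqP[s sE] := finA _ aA.
exists (\max_(i <- s) i).+1 => i ltsi; apply: contrapT => nlt.
have : i \in s by have : [set` s] i by rewrite -sE.
by move=> /(@leq_bigmax_seq _ _ xpredT id) -/(_ isT); rewrite leqNgt ltsi.
Qed.

(** * Polynomials with integer coefficients, and their reductions modulo a prime *)

Section ZPoly.
Context {d : nat}.
Implicit Types (F G : ZX d) (i j : 'I_d) (S : {set 'I_d}).

Definition var i : ZX d := mpolyX int (mnm1 i).

(** Differences and multiplications by variables reach all polynomials from 1, so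
    that ideals, ring morphisms and module actions can be tested on variables. *)
Lemma zpoly_ind (P : ZX d -> Prop) :
    P 1 -> (forall F G, P F -> P G -> P (F - G)) ->
    (forall i F, P F -> P (var i * F)) ->
  forall F, P F.
Proof.
move=> P1 PB PX.
have P0 : P 0 by rewrite -(subrr 1); exact: PB.
have PN F : P F -> P (- F) by rewrite -sub0r => ?; exact: PB.
have PD F G : P F -> P G -> P (F + G) by rewrite -{2}(opprK G) => ? /PN; exact: PB.
have PZ F (c : int) : P F -> P (c *: F).
  move=> PF; rewrite -[c]intz scaler_int -mulrzl.
  have PMn (n : nat) : P (n%:~R * F).
    elim: n => [|n IHn]; first by rewrite mul0r.
    by rewrite -addn1 PoszD intrD mulrDl mul1r; exact: PD.
  case: c => n; first exact: PMn.
  by rewrite NegzE intrN mulNr; exact/PN/PMn.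
have PXm (m : multinom d) : P (mpolyX int m).
  rewrite mpolyXE_id; elim: (index_enum _) => [|i s IHs]; first by rewrite big_nil.
  rewrite big_cons; elim: (m i) => [|k IHk]; first by rewrite expr0 mul1r.
  by rewrite exprS -mulrA; exact: PX.
by elim/mpolyind => // c m F _ _ PF; apply: PD => //; exact: PZ.
Qed.

Section Substitution.
Context {S : comNzRingType}.

Definition subst (h : 'I_d -> S) : {rmorphism ZX d -> S} := mmap (intr : int -> S) h.
Arguments subst : simpl never.

Lemma substX h i : subst h (var i) = h i.
Proof. by rewrite /subst /= mmapX mmap1U. Qed.

Lemma zpoly_rmorph_ext (f g : {rmorphism ZX d -> S}) :
  (forall i, f (var i) = g (var i)) -> f =1 g.
Proof.
move=> fgX; elim/zpoly_ind => [|F G|i F IH]; first by rewrite !rmorph1.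
  by rewrite !rmorphB => -> ->.
by rewrite !rmorphM IH fgX.
Qed.

End Substitution.

Definition reduce (K : comNzRingType) : {rmorphism ZX d -> mpoly d K} :=
  map_mpoly (intr : int -> K).
Arguments reduce : simpl never.

Lemma reduceX (K : comNzRingType) i : reduce K (var i) = mpolyX K (mnm1 i).
Proof. by rewrite /reduce /= map_mpolyX. Qed.

(** The kernel of the reduction modulo p; the ideals used below contain p, and
    so working over the integers replaces working over F_p. *)
Definition pdvd (p : nat) F := exists F', F = p%:R * F'.

Lemma pdvd_rmorph0 (R : comNzRingType) (f : {rmorphism ZX d -> R}) p F :
  p%:R = 0 :> R -> pdvd p F -> f F = 0.
Proof. by move=> p0 [F' ->]; rewrite rmorphM rmorph_nat p0 mul0r. Qed.

Lemma natr_pchar_mpoly (K : fieldType) p : p \in [pchar K] -> p%:R = 0 :> mpoly d K.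
Proof. by move/pcharf0 => p0; rewrite -mpolyC_nat p0 mpolyC0. Qed.

Lemma pdvd_of_reduce0_char (K : fieldType) p F : p \in [pchar K] -> reduce K F = 0 -> pdvd p F.
Proof.
move=> pK F0.
exists (\sum_(m <- msupp F) (divz (mcoeff m F) p) *: mpolyX int m).
rewrite {1}[F]mpolyE mulr_sumr; apply: eq_bigr => m _.
rewrite mulr_natl -scaler_nat scalerA; congr (_ *: _).
have : ((mcoeff m F)%:~R == 0 :> K).
  by move: (mcoeff_map_mpoly (intr : int -> K) m F); rewrite -/(reduce K F) F0 mcoeff0 => <-.
rewrite -(dvdz_pcharf pK) => /divzK {1}<-; rewrite mulrC natz //.
Qed.

(** The retraction onto the polynomials in the variables of S. Describing this
    subring by the fixed points of a ring morphism makes its closure properties,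
    also under determinants, immediate. *)
Definition keep_vars S : {rmorphism ZX d -> ZX d} :=
  subst (fun i => if i \in S then var i else 0).
Arguments keep_vars : simpl never.

Lemma keep_vars_var S i : keep_vars S (var i) = if i \in S then var i else 0.
Proof. exact: substX. Qed.

Definition in_vars S F := keep_vars S F = F.

Lemma in_vars0 S : in_vars S 0. Proof. exact: rmorph0. Qed.
Lemma in_vars1 S : in_vars S 1. Proof. exact: rmorph1. Qed.
Lemma in_varsB S F G : in_vars S F -> in_vars S G -> in_vars S (F - G).
Proof. by rewrite /in_vars rmorphB => -> ->. Qed.
Lemma in_varsM S F G : in_vars S F -> in_vars S G -> in_vars S (F * G).
Proof. by rewrite /in_vars rmorphM => -> ->. Qed.
Lemma in_varsX S F n : in_vars S F -> in_vars S (F ^+ n).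
Proof. by rewrite /in_vars rmorphXn => ->. Qed.
Lemma in_vars_prod S (I : Type) (s : seq I) (P : pred I) (f : I -> ZX d) :
  (forall k, P k -> in_vars S (f k)) -> in_vars S (\prod_(k <- s | P k) f k).
Proof. by move=> Sf; rewrite /in_vars rmorph_prod; apply: eq_bigr. Qed.
Lemma in_vars_var S i : i \in S -> in_vars S (var i).
Proof. by move=> iS; rewrite /in_vars keep_vars_var iS. Qed.

Lemma zpoly_ext2 (T1 T2 T : comNzRingType) (f1 : {rmorphism ZX d -> T1})
    (f2 : {rmorphism T1 -> T}) (g1 : {rmorphism ZX d -> T2}) (g2 : {rmorphism T2 -> T}) F :
  (forall i, f2 (f1 (var i)) = g2 (g1 (var i))) -> f2 (f1 F) = g2 (g1 F).
Proof. by move=> E; exact: (@zpoly_rmorph_ext _ (f2 \o f1) (g2 \o g1) E F). Qed.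

Lemma in_vars_sub S S' F : S \subset S' -> in_vars S F -> in_vars S' F.
Proof.
move=> /fintype.subsetP SS' SF; rewrite /in_vars -SF.
apply: (@zpoly_ext2 _ _ _ (keep_vars S) (keep_vars S') (keep_vars S) idfun) => i /=.
rewrite keep_vars_var; case: ifP => iS; last exact: rmorph0.
by rewrite keep_vars_var SS'.
Qed.

Lemma in_vars_det S n (C : 'M[ZX d]_n) :
  (forall k l, in_vars S (C k l)) -> in_vars S (\det C).
Proof.
move=> SC; rewrite /in_vars -det_map_mx; congr (\det _).
by apply/matrixP => i j; rewrite mxE SC.
Qed.

Definition univ t : {rmorphism ZX d -> {poly ZX d}} :=
  subst (fun i => if i == t then 'X else (var i)%:P).
Arguments univ : simpl never.

Lemma univ_var t i : univ t (var i) = if i == t then 'X else (var i)%:P.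
Proof. exact: substX. Qed.

Lemma univK t F : (univ t F).[var t] = F.
Proof.
apply: (@zpoly_ext2 _ _ _ (univ t) (horner_eval (var t)) idfun idfun) => i /=.
rewrite univ_var /horner_eval.
by case: eqVneq => [->|_]; rewrite ?hornerX ?hornerC.
Qed.

(** The two ways of forgetting the variables outside S agree with the expansion
    in powers of the variable t, because they agree on every variable. *)
Lemma in_vars_univ S t F l : t \notin S ->
  in_vars (t |: S) F -> in_vars S (univ t F)`_l.
Proof.
move=> tS; rewrite /in_vars => SF.
have E : map_poly (keep_vars S) (univ t F) = univ t F; last by rewrite -[in RHS]E coef_map.
transitivity (univ t (keep_vars (t |: S) F)); last by rewrite SF.
apply: (@zpoly_ext2 _ _ _ (univ t) (map_poly (keep_vars S)) (keep_vars (t |: S)) (univ t)) => i.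
rewrite univ_var keep_vars_var in_setU1.
case: eqVneq => [->|it] /=; first by rewrite univ_var eqxx map_polyX.
rewrite map_polyC /= keep_vars_var; case: (i \in S); last by rewrite !rmorph0.
by rewrite univ_var (negPf it).
Qed.

Definition eval_var (K : comNzRingType) t (c : K) : {rmorphism ZX d -> mpoly d K} :=
  subst (fun i => if i == t then mpolyC d c else mpolyX K (mnm1 i)).
Arguments eval_var : simpl never.

Lemma eval_var_var (K : comNzRingType) t (c : K) i :
  eval_var t c (var i) = if i == t then mpolyC d c else mpolyX K (mnm1 i).
Proof. exact: substX. Qed.

Lemma univ_eval_var (K : comNzRingType) t (c : K) F :
  (map_poly (reduce K) (univ t F)).[mpolyC d c] = eval_var t c F.
Proof.
apply: (@zpoly_ext2 _ _ _ (univ t) (horner_eval (mpolyC d c) \o map_poly (reduce K))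
  (eval_var t c) idfun) => i.
rewrite univ_var eval_var_var /= /horner_eval.
case: eqVneq => _; first by rewrite map_polyX hornerX.
by rewrite map_polyC hornerC [LHS]reduceX.
Qed.

Lemma univ_reduce (K : comNzRingType) t F :
  (map_poly (reduce K) (univ t F)).[mpolyX K (mnm1 t)] = reduce K F.
Proof.
apply: (@zpoly_ext2 _ _ _ (univ t) (horner_eval (mpolyX K (mnm1 t)) \o map_poly (reduce K))
  (reduce K) idfun) => i.
rewrite univ_var [reduce K _]reduceX /= /horner_eval.
case: eqVneq => [->|_]; first by rewrite map_polyX hornerX.
by rewrite map_polyC hornerC [LHS]reduceX.
Qed.

Lemma eval_var_reduce (K : comNzRingType) S t (c : K) F :
  in_vars (S :\ t) F -> eval_var t c F = reduce K F.
Proof.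
move=> SF; rewrite -SF.
apply: (@zpoly_ext2 _ _ _ (keep_vars (S :\ t)) (eval_var t c) (keep_vars (S :\ t)) (reduce K)) => i.
rewrite keep_vars_var in_setD1; case: ifP => [/andP[it _]|_].
  by rewrite reduceX eval_var_var (negPf it).
by rewrite !rmorph0.
Qed.

End ZPoly.

(** * Variables that are algebraically free modulo an ideal *)

Section Ideals.
Context {d : nat}.
Implicit Types (F G : ZX d) (S : {set 'I_d}) (I J : set (ZX d)).

Record is_ideal I : Prop := IsIdeal {
  ideal0 : I 0;
  idealB : forall F G, I F -> I G -> I (F - G);
  idealM : forall F G, I G -> I (F * G) }.

Lemma idealN I F : is_ideal I -> I F -> I (- F).
Proof. by move=> iI IF; rewrite -sub0r; apply: idealB => //; exact: ideal0. Qed.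

Lemma idealD I F G : is_ideal I -> I F -> I G -> I (F + G).
Proof. by move=> iI IF IG; rewrite -[G]opprK; apply: idealB => //; exact: idealN. Qed.

Lemma ideal_sum I (T : Type) (s : seq T) (P : pred T) (f : T -> ZX d) :
  is_ideal I -> (forall k, P k -> I (f k)) -> I (\sum_(k <- s | P k) f k).
Proof. by move=> iI If; elim/big_ind: _ => //; [exact: ideal0|move=> *; exact: idealD]. Qed.

Lemma ideal_pdvd I p F : is_ideal I -> I p%:R -> pdvd p F -> I F.
Proof. by move=> iI Ip [F' ->]; rewrite mulrC; exact: idealM. Qed.

(** The variables in S are algebraically independent over F_p in the quotient by
    I, provided that p lies in I. *)
Definition free_mod p I S := forall F, in_vars S F -> I F -> pdvd p F.

Definition ideals_above I : set (set (ZX d)) := [set J | is_ideal J /\ I `<=` J].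

Section Algebraic.
Context {p : nat} (p_pr : prime p) {I : set (ZX d)} (iI : is_ideal I) (Ip : I p%:R).

Lemma pdvd_of_reduce0 F : reduce 'F_p F = 0 -> pdvd p F.
Proof. by apply: pdvd_of_reduce0_char; exact: pchar_Fp. Qed.

Lemma reduce_pdvd F : pdvd p F -> reduce 'F_p F = 0.
Proof. by apply: pdvd_rmorph0; apply: natr_pchar_mpoly; exact: pchar_Fp. Qed.

Lemma pdvd_Gauss F G : pdvd p (F * G) -> pdvd p F \/ pdvd p G.
Proof.
move=> /reduce_pdvd/eqP; rewrite rmorphM mulf_eq0 => /orP[]/eqP/pdvd_of_reduce0; tauto.
Qed.

(** A relation between t and the free variables, truncated at the highest power
    of t whose coefficient s is nonzero modulo p; the terms above it are multiples
    of p and so lie in I. *)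
Lemma algebraic_relation S t : t \notin S -> ~ free_mod p I (t |: S) ->
  exists D s (c : nat -> ZX d), [/\ in_vars S s, forall l, in_vars S (c l),
    ~ pdvd p s & I (s * var t ^+ D - \sum_(l < D) c l * var t ^+ l)].
Proof.
move=> tS /existsNP[F /not_implyP[SF /not_implyP[IF npF]]].
pose q := univ t F.
have Sq l : in_vars S q`_l by exact: in_vars_univ.
have FE : F = \sum_(l < size q) q`_l * var t ^+ l by rewrite -(univK t F) horner_coef.
have [l0 npl0] : exists l, ~ pdvd p q`_l.
  apply: contrapT => /forallNP pq; apply: npF; apply: pdvd_of_reduce0.
  rewrite FE rmorph_sum big1 // => l _; rewrite rmorphM reduce_pdvd ?mul0r //.
  by apply: contrapT; exact: pq.
have ex_l : exists l, `[< ~ pdvd p q`_l >] by exists l0; apply/asboolP.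
have ub_l l : `[< ~ pdvd p q`_l >] -> (l <= size q)%N.
  move=> /asboolP npl; rewrite leqNgt; apply/negP => ltl; apply: npl.
  by rewrite nth_default ?(ltnW ltl) //; exists 0; rewrite mulr0.
have [D /asboolP npD maxD] := ex_maxnP ex_l ub_l.
exists D, q`_D, (fun l => - q`_l); split => // [l|].
  by rewrite -sub0r; apply: in_varsB => //; exact: in_vars0.
have ltD : (D < size q)%N.
  rewrite ltnNge; apply/negP => leD; apply: npD.
  by rewrite nth_default //; exists 0; rewrite mulr0.
have -> : q`_D * var t ^+ D - \sum_(l < D) - q`_l * var t ^+ l =
    F - \sum_(D.+1 <= l < size q) q`_l * var t ^+ l.
  rewrite {1}FE -(big_mkord xpredT (fun l => q`_l * var t ^+ l)).
  rewrite (big_cat_nat (n := D.+1)) //= addrK big_nat_recr //= big_mkord addrC.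
  by congr (_ + _); rewrite -sumrN; apply: eq_bigr => l _; rewrite mulNr opprK.
apply: idealB => //; rewrite big_nat; apply: ideal_sum => // l /andP[ltl _].
rewrite mulrC; apply: idealM => //; apply: ideal_pdvd Ip _ => //.
by apply: contrapT => npl; have := maxD l (asboolT npl); rewrite leqNgt ltl.
Qed.

(** After the denominators s, the product of the leading coefficients of the
    relations of all further variables, the quotient by I is spanned over the free
    polynomial ring by the monomials with bounded exponents. So every h acts on
    this span by a matrix over the free polynomial ring, up to a power of s. *)
Lemma finite_over_free S :
    free_mod p I S -> (forall t, t \notin S -> ~ free_mod p I (t |: S)) ->
  exists s n (e : 'I_n -> ZX d), [/\ in_vars S s, ~ pdvd p s, (exists i, e i = 1) &
    forall h, exists m, forall i, exists c : 'I_n -> ZX d,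
      (forall j, in_vars S (c j)) /\ I (s ^+ m * h * e i - \sum_j c j * e j)].
Proof.
move=> freeS maxS.
have ex_rel t : exists r : nat * ZX d * (nat -> ZX d), t \notin S ->
   [/\ in_vars S r.1.2, forall l, in_vars S (r.2 l), ~ pdvd p r.1.2 &
     I (r.1.2 * var t ^+ r.1.1 - \sum_(l < r.1.1) r.2 l * var t ^+ l)].
  case: (boolP (t \in S)) => tS; first by exists (0%N, 0, fun=> 0).
  by have [D [s [c ?]]] := algebraic_relation tS (maxS t tS); exists (D, s, c).
have [rel relP] := choice ex_rel.
(* One bound D for all variables: the relations may be multiplied by powers of
   their variable. *)
pose D := (\max_t (rel t).1.1)%N.
pose s : ZX d := \prod_(t | t \notin S) (rel t).1.2.
pose B := {ffun 'I_d -> 'I_D.+1}.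
pose e (a : B) : ZX d := \prod_j var j ^+ a j.
have Ss : in_vars S s by apply: in_vars_prod => t /relP[].
(* The span modulo I, over the free polynomial ring, of the monomials e a. *)
pose W (w : ZX d) := exists c : B -> ZX d, (forall a, in_vars S (c a)) /\ I (w - \sum_a c a * e a).
have WI w : I w -> W w.
  by exists (fun=> 0); split=> [a|]; [exact: in_vars0|rewrite big1 ?subr0 // => a _; rewrite mul0r].
have WB w w' : W w -> W w' -> W (w - w').
  move=> [c [Sc Ic]] [c' [Sc' Ic']]; exists (fun a => c a - c' a); split=> [a|].
    exact: in_varsB.
  under eq_bigr do rewrite mulrBl.
  by rewrite sumrB; have := idealB iI Ic Ic'; congr (I _); ring.
have W0 : W 0 by apply: WI; exact: ideal0.
have WD w w' : W w -> W w' -> W (w + w').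
  by move=> Ww Ww'; rewrite -[w']opprK; apply: (WB) => //; rewrite -sub0r; exact: WB.
have WZ a w : in_vars S a -> W w -> W (a * w).
  move=> Sa [c [Sc Ic]]; exists (fun b => a * c b); split=> [b|]; first exact: in_varsM.
  by under eq_bigr do rewrite -mulrA; rewrite -mulr_sumr -mulrBr; exact: idealM.
have Wsum (T : Type) (r : seq T) (P : pred T) f :
    (forall k, P k -> W (f k)) -> W (\sum_(k <- r | P k) f k).
  by move=> Wf; elim/big_ind: _.
have We a : W (e a).
  exists (fun b => (b == a)%:R); split=> [b|].
    by case: eqP => _; [exact: in_vars1|exact: in_vars0].
  rewrite (bigD1 a) //= eqxx mul1r big1 ?addr0 ?subrr; first exact: ideal0.
  by move=> b /negPf->; rewrite mul0r.
have eS t (a : B) k (lek : (k < D.+1)%N) :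
    var t ^+ k * \prod_(j | j != t) var j ^+ a j =
    e [ffun j => if j == t then Ordinal lek else a j].
  rewrite /e [in RHS](bigD1 t) //= ffunE eqxx; congr (_ * _).
  by apply: eq_bigr => j /negPf jt; rewrite ffunE jt.
have WXe t a : W (s * var t * e a).
  case: (boolP (t \in S)) => tS.
    by apply: WZ (We a); apply: in_varsM => //; exact: in_vars_var.
  rewrite {1}/e (bigD1 t) //= !mulrA -[s * _ * _]mulrA -exprS.
  have [ltD|geD] := ltnP (a t).+1 D.+1.
    by rewrite -mulrA (eS t a _ ltD); exact: WZ.
  have {geD} -> : (a t).+1 = D.+1 by apply/eqP; rewrite eqn_leq geD ltn_ord.
  have [Sst Sct _ It] := relP t tS.
  have leD : ((rel t).1.1 <= D)%N by rewrite /D (leq_bigmax t).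
  set E := \prod_(j | j != t) _.
  have -> : s * var t ^+ D.+1 * E = (\prod_(j | (j \notin S) && (j != t)) (rel j).1.2) *
      (((rel t).1.2 * var t ^+ (rel t).1.1) * (var t ^+ (D.+1 - (rel t).1.1) * E)).
    have mulE (u v x y z : ZX d) : u * v * (x * y) * z = v * (u * y * (x * z)) by ring.
    by rewrite /s (bigD1 t) //= -{1}(subnK (leqW leD)) exprD mulE.
  apply: (WZ); first by apply: in_vars_prod => j /andP[/relP[]].
  rewrite -[X in W (X * _)](subrK (\sum_(l < (rel t).1.1) (rel t).2 l * var t ^+ l)).
  rewrite mulrDl; apply: WD.
    by apply: WI; rewrite mulrC; exact: idealM.
  rewrite mulr_suml; apply: Wsum => l _; rewrite -mulrA; apply: WZ => //.
  rewrite mulrA -exprD.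
  have lt_l : (l + (D.+1 - (rel t).1.1) < D.+1)%N.
    rewrite -[X in (_ < X)%N](subnKC (leqW leD)) ltn_add2r //.
  by rewrite (eS t a _ lt_l).
have WX t w : W w -> W (s * var t * w).
  move=> [c [Sc Ic]]; rewrite -(subrK (\sum_a c a * e a) w) mulrDr; apply: WD.
    by apply: WI; exact: idealM.
  by rewrite mulr_sumr; apply: Wsum => a _; rewrite mulrCA; exact: WZ.
have WR (h : ZX d) : exists m, forall w, W w -> W (s ^+ m * h * w).
  elim/(@zpoly_ind d): h => [|F G [mF WF] [mG WG]|t F [m WF]].
  - by exists 0%N => w; rewrite expr0 !mul1r.
  - exists (mF + mG)%N => w Ww; rewrite mulrBr mulrBl; apply: WB.
      rewrite exprD [s ^+ mF * _]mulrC -!mulrA; apply: (WZ); first exact: in_varsX.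
      by rewrite mulrA; exact: WF.
    by rewrite exprD -!mulrA; apply: WZ; [exact: in_varsX|rewrite mulrA; exact: WG].
  - exists m.+1 => w /WF/(WX t); congr W.
    by rewrite exprS -!mulrA; congr (_ * _); rewrite mulrCA.
exists s, #|{: B}|, (fun i => e (enum_val i)); split => //.
- rewrite /s; elim/big_ind: _ => [[F' E]|F G npF npG|t /relP[]//].
    have := @reduce_pdvd 1 (ex_intro _ F' E); rewrite rmorph1 => /eqP.
    by rewrite oner_eq0.
  by case/pdvd_Gauss.
- exists (enum_rank ([ffun=> ord0] : B)); rewrite enum_rankK /e big1 // => j _.
  by rewrite ffunE expr0.
- move=> h; have [m Wh] := WR h; exists m => i.
  have [c [Sc Ic]] := Wh _ (We (enum_val i)).
  exists (fun j => c (enum_val j)); split => //.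
  by rewrite [in X in I X](reindex _ (onW_bij _ (@enum_val_bij B))) in Ic.
Qed.

End Algebraic.
End Ideals.

(** * Free sets of variables are bounded by the deviation *)

Section FreeDeviation.
Context {d : nat} {p : nat} (p_pr : prime p).
Implicit Types (F G : ZX d) (S : {set 'I_d}) (I J : set (ZX d)).

Definition colon I Y := [set F | I (F * Y)].
Definition add_principal I Y := [set F | exists G, I (F - G * Y)].

Lemma colon_ideal I Y : is_ideal I -> is_ideal (colon I Y).
Proof.
move=> iI; split; rewrite /colon /=.
- by rewrite mul0r; exact: ideal0.
- by move=> F G IF IG; rewrite mulrBl; exact: idealB.
- by move=> F G IG; rewrite -mulrA; exact: idealM.
Qed.

Lemma add_principal_ideal I Y : is_ideal I -> is_ideal (add_principal I Y).
Proof.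
move=> iI; split; rewrite /add_principal /=.
- by exists 0; rewrite mul0r subr0; exact: ideal0.
- move=> F G [F' IF] [G' IG]; exists (F' - G').
  by have := idealB iI IF IG; congr (I _); ring.
- move=> F G [G' IG]; exists (F * G').
  by have := idealM iI F IG; congr (I _); ring.
Qed.

(** Multiplication by Y identifies the quotient by the colon ideal with a cyclic
    submodule of J / I. *)
Lemma deviation_colon n I J Y : is_ideal I -> is_ideal J ->
  (forall F, I F -> J F) -> J Y ->
  deviation_lt n (ideals_above I `&` [set J' | (I <= J' <= J)%O]) ->
  deviation_lt n (ideals_above (colon I Y)).
Proof.
move=> iI iJ IJ JY.
pose f (A : set (ZX d)) : set (ZX d) := [set F | exists2 G, A G & I (F - G * Y)].
apply: (@deviation_lt_homo _ _ _ _ f).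
- move=> A [iA colA]; split; [split|].
  + split=> /=.
    * exists 0; first exact: ideal0.
      by rewrite mul0r subr0; exact: ideal0.
    * move=> F G [F' AF IF] [G' AG IG]; exists (F' - G'); first exact: idealB.
      by have := idealB iI IF IG; congr (I _); ring.
    * move=> F G [G' AG IG]; exists (F * G'); first exact: idealM.
      by have := idealM iI F IG; congr (I _); ring.
  + by move=> F IF /=; exists 0; [exact: ideal0|rewrite mul0r subr0].
  + apply/andP; split; apply/subsetPset.
      by move=> F IF /=; exists 0; [exact: ideal0|rewrite mul0r subr0].
    move=> F [G AG IG]; rewrite -(subrK (G * Y) F).
    by apply: idealD; [|exact: IJ|exact: idealM].
- move=> A A' _ _ /subsetPset AA'; apply/subsetPset => F [G /AA' AG IG].
  by exists G.
- move=> A A' [iA colA] [iA' colA'] /subsetPset AA' E.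
  apply/seteqP; split=> // F A'F.
  have : f A (F * Y).
    by rewrite E; exists F => //; rewrite subrr; exact: ideal0.
  move=> [G AG IG]; rewrite -(subrK G F); apply: idealD => //.
  by apply: colA; rewrite /colon /= mulrBl.
Qed.

Lemma maximal_free I S : free_mod p I S -> exists S', [/\ S \subset S', free_mod p I S' &
   forall t, t \notin S' -> ~ free_mod p I (t |: S')].
Proof.
move=> freeS; pose P (S' : {set 'I_d}) := `[< free_mod p I S' >].
have PS : P S by exact/asboolP.
have [S' /maxsetP[/asboolP freeS' maxS'] SS'] := maxset_exists PS.
exists S'; split => // t tS' freet.
have := maxS' (t |: S') (asboolT freet) (finset.subsetU1 _ _) => E.
by move: tS'; rewrite -E setU11.
Qed.

(** The factors of the descending chain. The variable t minus a constant would not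
    do, as t - c may be invertible in the quotient for each of the finitely many
    constants c in F_p; this polynomial vanishes on the whole field with
    p^(i+1) elements. *)
Definition chain_poly t i : ZX d := var t ^+ (p ^ i.+1) - var t.
Definition chain_prod t i : ZX d := \prod_(j < i) chain_poly t j.

Lemma chain_prod_npdvd t i : ~ pdvd p (chain_prod t i).
Proof.
move/(reduce_pdvd p_pr)/eqP; rewrite rmorph_prod prodf_seq_eq0 => /hasP[j _] /=.
rewrite /chain_poly rmorphB rmorphXn reduceX mpolyXn subr_eq0 => /eqP/(congr1 (mcoeff (mnm1 t))).
rewrite !mcoeffX eqxx; case: eqP => [/(congr1 (fun m : multinom d => m t))|_].
  rewrite mulmnE !mnm1E eqxx mul1n => E.
  by have := prime_gt1 p_pr; rewrite -(ltn_exp2r _ _ (ltn0Sn j)) exp1n E.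
by move=> /eqP; rewrite eq_sym oner_eq0.
Qed.

(** Suppose in the induction step that S is free with more than n elements, and
    make it maximal. Along the chain of the ideals (Y_i) + I the induction
    hypothesis yields a relation f Y_i = h y_i Y_i modulo I with f nonzero modulo
    p and not involving t. Multiplication by h has a matrix C over the free
    polynomial ring with denominator s^m, so that the determinant of s^m f - y_i C
    is zero modulo p. But for t = c in the field with p^(i+1) elements, where y_i
    is zero, it is a power of s^m f, which is not zero if c is not a root of s. *)
Lemma free_mod_lt n I S : is_ideal I -> I p%:R ->
  deviation_lt n (ideals_above I) -> free_mod p I S -> (#|S| < n)%N.
Proof.
elim: n I S => [|n IHn] I S iI Ip devI freeS.
  have iT : is_ideal (@setT (ZX d)) by split.
  have IE : I = setT.
    apply: devI; [by split|by split|].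
    exact/subsetPset/subsetT.
  have := freeS 1 (in_vars1 S); rewrite IE => /(_ Logic.I) /(reduce_pdvd p_pr)/eqP.
  by rewrite rmorph1 oner_eq0.
rewrite ltnS leqNgt; apply/negP => lt_n.
have [S' [SS' freeS' maxS']] := maximal_free freeS.
have {S SS' freeS lt_n} ltnS' : (n < #|S'|)%N := leq_trans lt_n (subset_leq_card SS').
have /card_gt0P[t tS'] : (0 < #|S'|)%N by exact: leq_trans ltnS'.
pose Y i := chain_prod t i; pose y i := chain_poly t i.
have YS i : Y i.+1 = y i * Y i by rewrite /Y /chain_prod big_ord_recr mulrC.
pose In i := add_principal I (Y i).
have iIn i : is_ideal (In i) by exact: add_principal_ideal.
have IIn i F : I F -> In i F by exists 0; rewrite mul0r subr0.
have In_dec i F : In i.+1 F -> In i F.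
  by move=> [G IG]; exists (G * y i); rewrite -mulrA -YS.
have chIn : descending_chain (ideals_above I) In.
  split=> i; first by split=> // F; exact: IIn.
  exact/subsetPset/In_dec.
have [N devN] := deviation_lt_factor devI chIn.
have [s [k [e [Ss nps [i0 e1] fin]]]] := finite_over_free p_pr iI Ip freeS' maxS'.
(* At least N for the relation of the chain, and large enough that s has fewer
   roots than there are elements in the field with p^(i+1) elements. *)
pose i := maxn N (size (univ t s)).
have {devN} devi := devN i (leq_maxl _ _).
have Icol : colon (In i.+1) (Y i) p%:R.
  by apply: IIn; rewrite mulrC; exact: idealM.
have {devi} : deviation_lt n (ideals_above (colon (In i.+1) (Y i))).
  apply: deviation_colon (iIn i.+1) (iIn i) (@In_dec i) _ _.
    by exists 1; rewrite mul1r subrr; exact: ideal0.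
  apply: (@deviation_lt_homo _ _ _ _ id) devi => [A [[iA IA] IAI]|//|//].
  split; [split=> //|exact: IAI].
  by apply: subset_trans IA; exact: IIn.
move=> /(IHn _ (S' :\ t) (colon_ideal _ (iIn _)) Icol) notfree.
have : ~ free_mod p (colon (In i.+1) (Y i)) (S' :\ t).
  move=> /notfree; apply/negP; rewrite -leqNgt.
  by move: ltnS'; rewrite (cardsD1 t) tS' add1n ltnS.
move=> /existsNP[f /not_implyP[Sf /not_implyP[[h Ih] npf]]].
have {Sf} [Sf S'f] := (Sf, in_vars_sub (subD1set S' t) Sf).
have [m /choice[C /all_and2[SC IC]]] := fin h.
(* This matrix maps the vector of the e a into I, after multiplication by Y i. *)
pose M := (s ^+ m * f)%:M - y i *: \matrix_(a, b) C a b.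
have S'y : in_vars S' (y i).
  by apply: in_varsB; [apply: in_varsX|]; exact: in_vars_var.
have SM a b : in_vars S' (M a b).
  rewrite !mxE; apply: in_varsB; last exact: in_varsM.
  case: eqP => _; last by rewrite mulr0n; exact: in_vars0.
  by rewrite mulr1n; apply: in_varsM => //; exact: in_varsX.
have Idet : I (\det M * Y i).
  pose ev := \col_a e a.
  have -> : \det M * Y i = \sum_a (\adj M) i0 a * ((M *m ev) a 0 * Y i).
    transitivity ((\adj M *m (M *m ev)) i0 0 * Y i).
      by rewrite mulmxA mul_adj_mx mul_scalar_mx !mxE e1 mulr1.
    by rewrite mxE mulr_suml; apply: eq_bigr => a _; rewrite mulrA.
  apply: ideal_sum => // a _; apply: idealM => //.
  have -> : (M *m ev) a 0 * Y i = (s ^+ m * e a) * (f * Y i - h * Y i.+1) +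
      (y i * Y i) * (s ^+ m * h * e a - \sum_b C a b * e b).
    rewrite /M mulmxBl mul_scalar_mx -scalemxAl !mxE YS.
    under eq_bigr do rewrite !mxE.
    ring.
  by apply: idealD => //; exact: idealM.
have npY : ~ pdvd p (Y i) by exact: chain_prod_npdvd.
have SY : in_vars S' (Y i).
  apply: in_vars_prod => j _; apply: in_varsB; [apply: in_varsX|]; exact: in_vars_var.
have pdet : pdvd p (\det M).
  by have /(pdvd_Gauss p_pr)[] := freeS' _ (in_varsM (in_vars_det SM) SY) Idet.
(* The determinant vanishes modulo p; this is contradicted in characteristic p at
   a suitable value c of t. *)
have [K pK cardK] := PrimePowerField p_pr (ltn0Sn i).
have [c evs] : exists c : K, eval_var t c s != 0.
  pose q := map_poly (reduce K) (univ t s).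
  have q0 : q != 0.
    apply: contra_notN nps => /eqP q0; apply: (pdvd_of_reduce0_char pK).
    by rewrite -(univ_reduce K t) -/q q0 horner0.
  apply: contrapT => /forallNP allroot.
  have rootq : all (root q) [seq mpolyC d c | c <- enum K].
    apply/allP => _ /mapP[c _ ->]; apply/eqP; rewrite univ_eval_var.
    by apply: contrapT => /eqP; exact: allroot.
  have uniqK : uniq [seq mpolyC d c | c <- enum K].
    rewrite map_inj_uniq ?enum_uniq // => a b /(congr1 (mcoeff mnm0)).
    by rewrite !mcoeffC eqxx !mulr1.
  have := max_poly_roots q0 rootq uniqK.
  rewrite size_map -cardE cardK ltnNge => /negP; apply.
  apply: leq_trans (size_poly _ _) _.
  apply: leq_trans (leq_maxr N _) (ltnW (leq_trans (ltnSn _) _)).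
  exact: ltnW (ltn_expl i.+1 (prime_gt1 p_pr)).
have evy : eval_var t c (y i) = 0.
  rewrite /y /chain_poly rmorphB rmorphXn eval_var_var eqxx.
  by rewrite -rmorphXn -cardK expf_card subrr.
have evf : eval_var t c f != 0.
  rewrite (eval_var_reduce c Sf); apply: contra_notN npf => /eqP.
  exact: pdvd_of_reduce0_char.
have := pdvd_rmorph0 (eval_var t c) (natr_pchar_mpoly pK) pdet.
rewrite -det_map_mx => /eqP.
have -> : map_mx (eval_var t c) M = (eval_var t c (s ^+ m * f))%:M.
  by rewrite map_mxB map_scalar_mx map_mxZ evy scale0r subr0.
rewrite det_scalar expf_eq0 rmorphM rmorphXn mulf_eq0 expf_eq0 (negPf evs).
by rewrite (negPf evf) !andbF.
Qed.

End FreeDeviation.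

(** * Polynomials in commuting endomorphisms of an abelian group *)

Section Action.
Context {d : nat} {A : zmodType} (act : 'I_d -> {additive A -> A}).
Hypothesis actC : forall i j a, act i (act j a) = act j (act i a).
Implicit Types (a b : A) (m : multinom d) (F G : ZX d).

Definition act_mon m b := foldr (fun i x => iter (m i) (act i) x) b (enum 'I_d).

Lemma act_mon0 b : act_mon mnm0 b = b.
Proof. by rewrite /act_mon; elim: (enum _) => //= i s ->; rewrite mnm0E. Qed.

Lemma act_monU i m b : act_mon (mnm_add (mnm1 i) m) b = act i (act_mon m b).
Proof.
rewrite /act_mon; move: (enum_uniq 'I_d) (mem_enum 'I_d i); rewrite inE.
have iterC j k x : iter k (act j) (act i x) = act i (iter k (act j) x).
  by elim: k => //= k ->; rewrite actC.
elim: (enum _) => //= j s IHs /andP[js us]; rewrite in_cons.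
rewrite mnmDE mnm1E; case: eqVneq => [->|ij] /=.
  move=> _; congr (act j _); congr (iter _ _ _).
  elim: s js {IHs us} => //= l s IHs; rewrite in_cons negb_or => /andP[jl js].
  by rewrite mnmDE mnm1E (negPf jl) IHs.
by move=> is_; rewrite IHs // iterC.
Qed.

Lemma act_monB m : {morph act_mon m : a b / a - b}.
Proof.
move=> a b; rewrite /act_mon; elim: (enum _) => //= i s ->.
by elim: (m i) => //= k ->; rewrite raddfB.
Qed.

Lemma act_monMn m n b : act_mon m (b *+ n) = act_mon m b *+ n.
Proof.
have act_mon_0 : act_mon m 0 = 0 by rewrite -{1}(subrr 0) act_monB subrr.
have act_monD x y : act_mon m (x + y) = act_mon m x + act_mon m y.
  by rewrite -{1}[y]opprK -[- y]sub0r !act_monB act_mon_0 sub0r opprK.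
elim: n => [|n IHn]; first by rewrite !mulr0n act_mon_0.
by rewrite !mulrS act_monD IHn.
Qed.

(** The product F.b, for the module structure in which the variable x_i acts as
    the endomorphism act i. *)
Definition act_poly b F := \sum_(m <- msupp F) act_mon m b *~ mcoeff m F.

Lemma act_polyE b F k : (msize F <= k)%N ->
  act_poly b F = \sum_(m : bmultinom d k) act_mon m b *~ mcoeff m F.
Proof.
move=> leFk; rewrite /act_poly (big_mksub (bmultinom d k)) ?msupp_uniq //=; last first.
  by move=> x /msize_mdeg_lt /leq_trans; apply.
by rewrite big_rmcond //= => j /memN_msupp_eq0 ->.
Qed.

Lemma act_polyB b : {morph act_poly b : F G / F - G}.
Proof.
move=> F G; pose k := maxn (msize (F - G)) (maxn (msize F) (msize G)).
have leFG : (msize (F - G) <= k)%N by rewrite leq_max leqnn.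
have leF : (msize F <= k)%N by rewrite !leq_max leqnn orbT.
have leG : (msize G <= k)%N by rewrite !leq_max leqnn !orbT.
rewrite !(@act_polyE _ _ k) // -sumrB; apply: eq_bigr => m _.
by rewrite mcoeffB mulrzBr.
Qed.

HB.instance Definition _ b := GRing.isZmodMorphism.Build _ _ (act_poly b) (act_polyB b).

Lemma act_polyZX b c m : act_poly b (c *: mpolyX int m) = act_mon m b *~ c.
Proof.
have [->|c0] := eqVneq c 0; first by rewrite scale0r raddf0 mulr0z.
by rewrite /act_poly msuppMCX // big_seq1 mcoeffZ mcoeffX eqxx mulr1.
Qed.

Lemma act_poly_var b i F : act_poly b (var i * F) = act i (act_poly b F).
Proof.
rewrite {1}[F]mpolyE mulr_sumr raddf_sum /act_poly raddf_sum /=; apply: eq_bigr => m _.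
by rewrite -scalerAr /var -mpolyXD [LHS]act_polyZX act_monU raddfMz.
Qed.

Lemma act_poly1 b : act_poly b 1 = b.
Proof. by rewrite -mpolyX0 -[mpolyX _ _]scale1r act_polyZX act_mon0. Qed.

Lemma act_poly_base b n F : act_poly (b *+ n) F = act_poly b (n%:R * F).
Proof.
rewrite mulr_natl raddfMn /= /act_poly -sumrMnl; apply: eq_bigr => m _.
by rewrite act_monMn pmulrn mulrzAC -pmulrn.
Qed.

Lemma act_poly_ker_ideal b : is_ideal [set F | act_poly b F = 0].
Proof.
split=> /= [|F G F0 G0|F G G0]; first exact: raddf0.
  by rewrite raddfB /= F0 G0 subr0.
elim/(@zpoly_ind d): F => [|F F' IHF IHF'|i F IH].
- by rewrite mul1r.
- by rewrite mulrBl raddfB /= IHF IHF' subrr.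
- by rewrite -mulrA act_poly_var IH raddf0.
Qed.

Record is_submodule (N : set A) : Prop := IsSubmodule {
  submod0 : N 0;
  submodB : forall a b, N a -> N b -> N (a - b);
  submod_act : forall i a, N a -> N (act i a) }.

(** The ideal of all F with F.b in pM, where M is the module generated by b: the
    module M / pM is the quotient by this ideal. *)
Definition ann_mod p b : set (ZX d) := [set F | exists G, act_poly b (F - p%:R * G) = 0].

Lemma ann_mod_ideal p b : is_ideal (ann_mod p b).
Proof.
have iK := act_poly_ker_ideal b; split=> /=.
- by exists 0; rewrite mulr0 subr0 raddf0.
- move=> F G [F' kF] [G' kG]; exists (F' - G').
  by have := idealB iK kF kG; rewrite /= => <-; congr (act_poly b); ring.
- move=> F G [G' kG]; exists (F * G').
  by have := idealM iK F kG; rewrite /= => <-; congr (act_poly b); ring.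
Qed.

(** An ideal J above the annihilator of b modulo p is determined by the submodule
    of all F.b with F in J. *)
Lemma deviation_ann_mod n p b : deviation_lt n [set N | is_submodule N] ->
  deviation_lt n (ideals_above (ann_mod p b)).
Proof.
pose f (J : set (ZX d)) : set A := [set act_poly b F | F in J].
apply: (@deviation_lt_homo _ _ _ _ f) => [J [iJ _]|J J' _ _|J J' [iJ kJ] [iJ' _]].
- split=> /=.
  + by exists 0; [exact: ideal0|exact: raddf0].
  + move=> _ _ [F JF <-] [G JG <-]; exists (F - G); [exact: idealB|exact: raddfB].
  + by move=> i _ [F JF <-]; exists (var i * F); [exact: idealM|exact: act_poly_var].
- by move=> /subsetPset JJ'; apply/subsetPset => _ [F /JJ' J'F <-]; exists F.
- move=> /subsetPset JJ' E; apply/seteqP; split=> // F J'F.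
  have : f J (act_poly b F) by rewrite E; exists F.
  move=> [G JG GF]; rewrite -(subrK G F); apply: idealD => //; apply: kJ.
  by exists 0; rewrite mulr0 subr0 raddfB /= GF subrr.
Qed.

End Action.

(** * Monomials with few large exponents *)

Section Standard.
Context {d : nat}.
Implicit Types (m : multinom d) (F G : ZX d) (S : {set 'I_d}).

Lemma in_vars_msupp S F m i : in_vars S F -> m \in msupp F -> i \notin S -> m i = 0%N.
Proof.
move=> SF mF iS; apply/eqP; apply: contraLR mF => mi.
rewrite -mcoeff_eq0; pose S0 : {set 'I_d} := [set j | j != i]%SET.
have S0F : in_vars S0 F.
  apply: in_vars_sub SF; apply/fintype.subsetP => j jS; rewrite !inE.
  by apply: contraNneq iS => <-.
have keep_vars_mon (m' : multinom d) :
    keep_vars S0 (mpolyX int m') = (m' i == 0%N)%:R * mpolyX int m'.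
  rewrite mpolyXE_id rmorph_prod /=.
  case: eqP => [m'i|/eqP m'i].
    rewrite mul1r; apply: eq_bigr => j _; rewrite rmorphXn /= keep_vars_var !inE.
    by case: eqVneq => //= ->; rewrite m'i !expr0.
  rewrite mul0r (bigD1 i) //= rmorphXn /= keep_vars_var !inE eqxx /=.
  by rewrite expr0n (negPf m'i) mul0r.
rewrite -S0F {1}[F]mpolyE rmorph_sum /= raddf_sum big1 // => m' _.
rewrite -[mcoeff m' F]intz scaler_int rmorphMz /= keep_vars_mon.
rewrite raddfMz /=; case: (eqVneq (m' i) 0%N) => m'i; last by rewrite mul0r raddf0 mul0rz.
rewrite mul1r mcoeffX; case: eqP => [mE|_]; last by rewrite mul0rz.
by rewrite -mE m'i eqxx in mi.
Qed.

Definition std_exps (D k r : nat) : {set {ffun 'I_d -> 'I_r.+1}} :=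
  [set f : {ffun 'I_d -> 'I_r.+1} | (#|[set i : 'I_d | (D <= f i)%N]%SET| <= k)%N]%SET.

(** For each of the 2^d possible sets of large exponents, at most k exponents are
    free and the others are less than D. *)
Lemma card_std_exps D k r : (0 < D)%N ->
  (#|std_exps D k r| <= 2 ^ d * D ^ d * r.+1 ^ k)%N.
Proof.
move=> D0; pose fam (T : {set 'I_d}) : 'I_d -> pred 'I_r.+1 :=
  fun i x => (i \in T) || (x < D)%N.
have card_fam (T : {set 'I_d}) : (#|T| <= k)%N -> (#|family (fam T)| <= D ^ d * r.+1 ^ k)%N.
  move=> leTk; rewrite card_family foldrE big_map big_enum /=.
  apply: (@leq_trans (\prod_(i < d) (D * (if i \in T then r.+1 else 1)))).
    apply: leq_prod => i _; case: ifP => iT.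
      by apply: leq_trans (max_card _) _; rewrite card_ord leq_pmull.
    rewrite muln1 cardE -(size_map val) -[leqRHS](size_iota 0).
    apply: uniq_leq_size; first by rewrite map_inj_uniq ?enum_uniq //; exact: val_inj.
    by move=> _ /mapP[x xD ->]; move: xD; rewrite mem_enum unfold_in /fam iT mem_iota.
  rewrite big_split /= prod_nat_const card_ord leq_mul2l; apply/orP; right.
  rewrite -big_mkcond /= prod_nat_const leq_pexp2l //.
rewrite -sum1_card.
apply: (@leq_trans (\sum_(f in std_exps D k r)
    \sum_(T : {set 'I_d} | (#|T| <= k)%N) (f \in family (fam T)))).
  apply: leq_sum => f; rewrite inE => fk.
  rewrite (bigD1 [set i : 'I_d | (D <= f i)%N]%SET) //= [X in nat_of_bool X](_ : _ = true) //.
  by apply/familyP => i; rewrite unfold_in /fam inE; case: leqP.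
rewrite exchange_big /= -mulnA.
apply: (@leq_trans (\sum_(T : {set 'I_d} | (#|T| <= k)%N) (D ^ d * r.+1 ^ k))).
  apply: leq_sum => T /card_fam; apply: leq_trans.
  rewrite -sum1_card [leqRHS]big_mkcond /= [leqLHS]big_mkcond.
  by apply: leq_sum => f _; case: ifP => // _; case: ifP.
rewrite sum_nat_const leq_mul2r; apply/orP; right.
by apply: leq_trans (max_card _) _; rewrite -cardsT -powersetT card_powerset cardsT card_ord.
Qed.

End Standard.
Arguments std_exps : clear implicits.

(** * Growth of torsion modules of bounded deviation *)

(** Finite cardinality bounded by N. Covering lists, unlike cardinalities, need no
    finiteness to be stated and multiply directly under sums of sets. *)
Definition coverable (T : eqType) (X : set T) N :=
  exists2 s : seq T, (size s <= N)%N & forall x, X x -> x \in s.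

Section Growth.
Context {d : nat} {A : zmodType} (act : 'I_d -> {additive A -> A}).
Hypothesis actC : forall i j a, act i (act j a) = act j (act i a).
Implicit Types (a b : A) (m : multinom d) (F G : ZX d) (S : {set 'I_d}).
Local Notation act_poly := (act_poly act).

Section Reduction.
Context {p : nat} (p_pr : prime p) (b : A).

(** A relation in I is not zero modulo p, so that after multiplication by an
    integer its leading monomial modulo p has coefficient 1 modulo p. All
    coefficients that vanish modulo p, possibly in higher degree, go into H. *)
Lemma lead_relation S : ~ free_mod p (ann_mod act p b) S ->
  exists (m : multinom d) L H, [/\ forall i, i \notin S -> m i = 0%N,
    forall m', m' \in msupp L -> (m' < m)%O &
    act_poly b (mpolyX int m - L - p%:R * H) = 0].
Proof.
move=> /existsNP[F /not_implyP[SF /not_implyP[[H0 IH0] npF]]].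
pose rF := reduce 'F_p F; pose m := mlead rF.
have rF0 : rF != 0 by apply: contra_notN npF => /eqP; exact: pdvd_of_reduce0.
have coef_rF m' : mcoeff m' rF = (mcoeff m' F)%:~R by exact: mcoeff_map_mpoly.
have nzm : (mcoeff m F)%:~R != 0 :> 'F_p.
  by rewrite -coef_rF -mcoeff_msupp; exact: mlead_supp.
have mF : m \in msupp F by rewrite mcoeff_msupp; apply: contraNneq nzm => ->.
pose u : int := (nat_of_ord ((mcoeff m F)%:~R^-1 : 'F_p))%:Z.
have uE : u%:~R * (mcoeff m F)%:~R = 1 :> 'F_p.
  by rewrite /u -pmulrn natr_Zp mulVf.
pose E := mpolyX int m - u%:~R * F.
pose L := \sum_(m' <- msupp E | (m' < m)%O) mcoeff m' E *: mpolyX int m'.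
have coefL m' : mcoeff m' L = if (m' < m)%O then mcoeff m' E else 0.
  rewrite /L big_mkcond raddf_sum /=.
  have [m'E|m'E] := boolP (m' \in msupp E).
    rewrite (bigD1_seq m') ?msupp_uniq //= big1 => [|k /negPf km']; last first.
      by case: ifP => _; rewrite ?mcoeff0 // mcoeffZ mcoeffX km' mulr0.
    by case: ifP => _; rewrite ?mcoeff0 addr0 // mcoeffZ mcoeffX eqxx mulr1.
  rewrite (memN_msupp_eq0 m'E) if_same big1_seq // => k /andP[_ kE].
  case: ifP => _; rewrite ?mcoeff0 // mcoeffZ mcoeffX; case: eqP => [kE'|_]; last by rewrite mulr0.
  by rewrite kE' (negPf m'E) in kE.
have : pdvd p (E - L).
  apply: (pdvd_of_reduce0 p_pr); apply/mpolyP => m'.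
  rewrite mcoeff0 [LHS]mcoeff_map_mpoly mcoeffB coefL.
  case: ifP => [_|gem]; first by rewrite subrr.
  rewrite subr0 /E mcoeffB mcoeffX -[LHS]/((_ - _)%:~R) intrB.
  have -> : mcoeff m' (u%:~R * F) = u * mcoeff m' F.
    by rewrite mulrzl raddfMz /= mulrC -mulrzr intz.
  rewrite intrM; case: eqP => [<-|mm']; first by rewrite uE subrr.
  rewrite -coef_rF mcoeff_gt_mlead ?mulr0 ?subr0 // -/m.
  by rewrite lt_neqAle; apply/andP; split; [exact/eqP|rewrite leNgt gem].
move=> [H1 ELE]; exists m, L, (H1 + u%:~R * H0); split.
- by move=> i iS; apply: in_vars_msupp SF mF iS.
- by move=> m'; rewrite mcoeff_msupp coefL; case: ifP => //; rewrite eqxx.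
- have := act_poly_ker_ideal actC b => iK.
  have := idealM iK (u%:~R) IH0; rewrite /= => <-; congr (act_poly b _).
  have -> : mpolyX int m = p%:R * H1 + L + u%:~R * F by rewrite -ELE /E; ring.
  ring.
Qed.

Variables (k : nat) (mS : {set 'I_d} -> multinom d) (LS HS : {set 'I_d} -> ZX d).
Hypothesis mS_in : forall S i, #|S| = k -> i \notin S -> mS S i = 0%N.
Hypothesis LS_lt : forall S m', #|S| = k -> m' \in msupp (LS S) -> (m' < mS S)%O.
Hypothesis rel : forall S, #|S| = k -> act_poly b (mpolyX int (mS S) - LS S - p%:R * HS S) = 0.

(** The monomials that are not divisible by any leading monomial of a relation
    between k variables. *)
Definition standard m := forall S, #|S| = k -> ~~ lem (mS S) m.

(* The two accounts for the weak bound on the size of a product in msizeM_le. *)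
Let D' := (\max_(S : {set 'I_d}) msize (HS S)).+2.

(** The remainder G is not allowed to exceed the degree r, while the multiple of p
    may exceed it by a constant: it is measured in the smaller module generated by
    p b, where a shift of the radius by a constant is harmless. *)
Definition reduced r a := exists G H, [/\ forall m, m \in msupp G -> standard m /\ (mdeg m <= r)%N,
  (msize H <= r + D')%N & a = act_poly b (G + p%:R * H)].

Lemma reduced0 r : reduced r 0.
Proof.
exists 0, 0; split; [by move=> m; rewrite msupp0|by rewrite mmeasure0|].
by rewrite mulr0 addr0 raddf0.
Qed.

Lemma reducedB r a a' : reduced r a -> reduced r a' -> reduced r (a - a').
Proof.
move=> [G [H [sG sH ->]]] [G' [H' [sG' sH' ->]]]; exists (G - G'), (H - H'); split.
- by move=> m /msuppB_le; rewrite mem_cat => /orP[/sG|/sG'].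
- by apply: leq_trans (mmeasureD_le _ _ _) _; rewrite mmeasureN geq_max sH.
- by rewrite -raddfB /=; congr (act_poly b _); ring.
Qed.

Lemma reducedD r a a' : reduced r a -> reduced r a' -> reduced r (a + a').
Proof.
move=> ra ra'; rewrite -[a']opprK; apply: reducedB => //.
by rewrite -sub0r; apply: reducedB => //; exact: reduced0.
Qed.

Lemma reducedMz r a c : reduced r a -> reduced r (a *~ c).
Proof.
move=> ra; have rMn n : reduced r (a *+ n).
  by elim: n => [|n IHn]; rewrite ?mulr0n ?mulrS; [exact: reduced0|exact: reducedD].
case: c => n; first by rewrite -pmulrn.
by rewrite NegzE mulrNz -sub0r; apply: reducedB; [exact: reduced0|rewrite -pmulrn].
Qed.

Lemma reduced_le r r' a : (r <= r')%N -> reduced r a -> reduced r' a.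
Proof.
move=> rr' [G [H [sG sH aE]]]; exists G, H; split=> //.
  by move=> m /sG[? /leq_trans]; split => //; auto.
by apply: leq_trans sH _; rewrite leq_add2r.
Qed.

Lemma reduced_act_poly r F : (forall m, m \in msupp F -> reduced r (act_poly b (mpolyX int m))) ->
  reduced r (act_poly b F).
Proof.
move=> rF; rewrite [F]mpolyE raddf_sum /= big_seq.
elim/big_ind: _ => [|? ? ? ?|m mF]; [exact: reduced0|exact: reducedD|].
by rewrite act_polyZX -[act_mon _ _ _]mulr1z -act_polyZX scale1r; apply: reducedMz; exact: rF.
Qed.

(** Each rewriting step replaces a multiple of a leading monomial by smaller
    monomials. As the order is graded, degrees never increase, and only one
    multiple of p with a bounded excess of degree is added at each step. *)
Lemma reduced_monomial m : reduced (mdeg m) (act_poly b (mpolyX int m)).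
Proof.
elim/(@ltmwf d): m => m IH.
have [[S [cS leS]]|nstd] := pselect (exists S, #|S| = k /\ lem (mS S) m); last first.
  exists (mpolyX int m), 0; split; [|by rewrite mmeasure0|by rewrite mulr0 addr0].
  move=> m'; rewrite msuppX inE => /eqP->; split=> // S cS; apply/negP => leS.
  by apply: nstd; exists S.
(* Multiply the relation of S by the cofactor m0 of its leading monomial. *)
set m0 := mnm_sub m (mS S); have mE : m = mnm_add m0 (mS S) by rewrite submK.
have -> : act_poly b (mpolyX int m) = act_poly b (mpolyX int m0 * LS S) +
    act_poly b (p%:R * (mpolyX int m0 * HS S)).
  apply/eqP; rewrite -subr_eq0 -raddfD -raddfB /=.
  have := idealM (act_poly_ker_ideal actC b) (mpolyX int m0) (rel cS) => /= <-.
  by apply/eqP; congr (act_poly b _); rewrite {1}mE mpolyXD; ring.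
apply: reducedD.
  rewrite mulrC; apply: reduced_act_poly => m'; rewrite (perm_mem (msuppMX _ _)).
  move=> /mapP[m'' m''L ->].
  have ltm : (mnm_add m0 m'' < m)%O by rewrite [ltRHS]mE ltmc_add2r; exact: LS_lt.
  by apply: reduced_le (IH _ ltm); apply: lemc_mdeg; exact: ltW.
exists 0, (mpolyX int m0 * HS S); split; last by rewrite add0r.
  by move=> m'; rewrite msupp0.
apply: leq_trans (msizeM_le _ _) _; rewrite msizeX addSn /=.
rewrite -!addnS; apply: leq_add; last by rewrite !ltnS (leq_bigmax S).
by rewrite mE mdegD leq_addr.
Qed.

Lemma reduced_all r F : (msize F <= r.+1)%N -> reduced r (act_poly b F).
Proof.
move=> sF; apply: reduced_act_poly => m mF; apply: reduced_le (reduced_monomial m).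
by rewrite -ltnS; apply: leq_trans (msize_mdeg_lt mF) sF.
Qed.


Definition orbit_ball b r : set A := [set act_poly b F | F in [set F : ZX d | (msize F <= r.+1)%N]].

Variables (D k' : nat).
Hypothesis k'k : k = k'.+1.
Hypothesis D_gt : forall S i, #|S| = k -> (mS S i < D)%N.

Definition mnm_of r (f : {ffun 'I_d -> 'I_r.+1}) : multinom d :=
  @Multinom d [tuple val (f i) | i < d].

Lemma mnm_ofE r (f : {ffun 'I_d -> 'I_r.+1}) i : mnm_of f i = f i.
Proof. by rewrite /mnm_of multinomE tnth_mktuple. Qed.

(** If k exponents were at least D, the leading monomial attached to these k
    variables would divide the monomial. *)
Lemma standard_exps m r : standard m -> (mdeg m <= r)%N ->
  exists2 f, f \in std_exps d D k' r & mnm_of f = m.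
Proof.
move=> stm degm.
have mi i : (m i < r.+1)%N.
  by rewrite ltnS (leq_trans _ degm) // mdegE (bigD1 i) //= leq_addr.
pose f := [ffun i => Ordinal (mi i)] : {ffun 'I_d -> 'I_r.+1}.
exists f; last by apply/mnmP => i; rewrite mnm_ofE ffunE.
rewrite inE leqNgt -k'k; apply/negP => /card_geqP[s [us ss sD]].
pose S : {set 'I_d} := [set i in s]%SET.
have cS : #|S| = k by rewrite cardsE (card_uniqP us).
have /negP := stm S cS; apply; apply/mnm_lepP => i.
have [iS|iS] := boolP (i \in S); last by rewrite mS_in.
have : i \in s by move: iS; rewrite inE.
by move=> /sD; rewrite inE ffunE /= => /(leq_trans (D_gt i cS)) /ltnW.
Qed.

(** The coefficients of a reduced remainder matter only modulo p, as their
    quotients by p are absorbed by the module generated by p b. So the ball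
    of b is covered by p choices for each standard monomial, times a ball of
    p b. *)
Lemma growth_step r N : coverable (orbit_ball (b *+ p) (r + D')) N ->
  coverable (orbit_ball b r) (p ^ #|std_exps d D k' r| * N).
Proof.
move=> [t st tP]; have p0 := prime_gt0 p_pr.
pose E := std_exps d D k' r.
(* Remainders modulo p are stored in the type with p.-1.+1 elements, which equals p. *)
pose lift0 (c : {ffun {ffun 'I_d -> 'I_r.+1} -> 'I_p.-1.+1}) :=
  \sum_(f in E) act_poly b (mpolyX int (mnm_of f)) *+ c f.
pose cs := enum (pffun_on ord0 (mem E) (@predT 'I_p.-1.+1)).
exists [seq lift0 c + y | c <- cs, y <- t].
  rewrite size_allpairs -cardE card_pffun_on card_ord prednK // leq_mul2l st orbT //.
move=> _ [F sF <-].
have [G [H [sG sH ->]]] := reduced_all sF.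
pose co (f : {ffun 'I_d -> 'I_r.+1}) := mcoeff (mnm_of f) G.
have mnm_inj : injective (@mnm_of r).
  by move=> f g E'; apply/ffunP => i; apply: val_inj; rewrite /= -!mnm_ofE E'.
have GE : G = \sum_(f in E) co f *: mpolyX int (mnm_of f).
  apply/mpolyP => m; rewrite raddf_sum /=.
  have [mG|mG] := boolP (m \in msupp G).
    have [stm degm] := sG m mG; have [f fE fm] := standard_exps stm degm.
    rewrite (bigD1 f) //= big1 ?addr0 => [|g /andP[_ gf]].
      by rewrite mcoeffZ mcoeffX fm eqxx mulr1 /co fm.
    rewrite mcoeffZ mcoeffX -fm; case: eqP => [/mnm_inj gE|_]; last by rewrite mulr0.
    by rewrite gE eqxx in gf.
  rewrite (memN_msupp_eq0 mG) big1 // => f _.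
  rewrite mcoeffZ mcoeffX /co; case: eqP => [->|_]; last by rewrite mulr0.
  by rewrite (memN_msupp_eq0 mG) mul0r.
pose G1 := \sum_(f in E) (co f %/ p)%Z *: mpolyX int (mnm_of f).
pose c := [ffun f => if f \in E then inord (absz (co f %% p)%Z) else ord0 : 'I_p.-1.+1].
apply/allpairsP; exists (c, act_poly (b *+ p) (G1 + H)); split => /=.
- rewrite mem_enum; apply/pffun_onP; split=> //.
  by apply/fintype.subsetP => f; rewrite inE /= ffunE; case: ifP => //; rewrite eqxx.
- apply: tP; exists (G1 + H) => //=.
  apply: leq_trans (mmeasureD_le _ _ _) _; rewrite geq_max; apply/andP; split.
    apply: leq_trans (mmeasure_sum _ _ _ _) _.
    apply/bigmax_leqP => f _; have [mG|mG] := boolP (mnm_of f \in msupp G); last first.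
      by rewrite /co (memN_msupp_eq0 mG) div0z scale0r mmeasure0.
    apply: leq_trans (mmeasureZ_le _ _ _) _; rewrite mmeasureX ltnS.
    by have [_ /leq_trans] := sG _ mG; apply; rewrite leq_addr.
  by apply: leq_trans sH _; exact: leqnSn.
- rewrite act_poly_base mulrDr 2!raddfD /= addrA; congr (_ + _).
  rewrite GE /lift0.
  rewrite [X in _ = _ + X](_ : _ =
    act_poly b (\sum_(f in E) (p%:Z * (co f %/ p)%Z) *: mpolyX int (mnm_of f))).
    rewrite !raddf_sum -big_split /=; apply: eq_bigr => f fE.
    rewrite !act_polyZX ffunE fE inordK; last first.
      rewrite prednK // -ltz_nat gez0_abs ?modz_ge0 ?ltz_pmod //;
        by rewrite ?ltz_nat -?lt0n // eqz_nat -lt0n.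
    rewrite -[mpolyX _ _]scale1r act_polyZX mulr1z pmulrn gez0_abs; last first.
      by rewrite modz_ge0 // eqz_nat -lt0n.
    by rewrite -mulrzDr {1}(divz_eq (co f) p) addrC mulrC.
  congr (act_poly b _); rewrite mulr_sumr; apply: eq_bigr => f _.
  by rewrite -scalerA mulr_natl -[p%:Z]natz scaler_nat.
Qed.

End Reduction.

(** Induction on the order of b, which decreases when b is replaced by p b for
    a prime divisor p. The deviation bounds the free sets of variables, and so
    provides the relation between any k + 1 variables that the reduction needs. *)
Theorem module_growth k : deviation_lt k.+1 [set N | is_submodule act N] ->
  forall q b, (0 < q)%N -> b *+ q = 0 ->
  exists C, forall r, coverable (orbit_ball b r) (2 ^ (C * r.+1 ^ k)).
Proof.
move=> devA; elim/ltn_ind => q IH b q0 bq0.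
have [q1|q1] := eqVneq q 1%N.
  exists 0%N => r; rewrite mul0n expn0; exists [:: 0] => // _ [F _ <-].
  move: bq0; rewrite q1 mulr1n => ->.
  rewrite inE /act_poly big1 // => m _.
  have -> : act_mon act m 0 = 0 by rewrite -(mulr0n (0 : A)) act_monMn mulr0n.
  by rewrite mul0rz.
have {}q1 : (1 < q)%N by rewrite ltn_neqAle eq_sym q1.
pose p := pdiv q; have p_pr : prime p by exact: pdiv_prime.
have [C' C'P] : exists C, forall r, coverable (orbit_ball (b *+ p) r) (2 ^ (C * r.+1 ^ k)).
  apply: (IH (q %/ p)%N).
  - by rewrite ltn_Pdiv // prime_gt1.
  - by rewrite divn_gt0 ?pdiv_leq // prime_gt0.
  - by rewrite -mulrnA mulnC divnK ?pdiv_dvd.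
pose I := ann_mod act p b.
have iI : is_ideal I by exact: ann_mod_ideal.
have Ip : I p%:R by exists 1; rewrite mulr1 subrr raddf0.
have nfree S : #|S| = k.+1 -> exists r : multinom d * ZX d * ZX d,
   [/\ forall i, i \notin S -> r.1.1 i = 0%N,
    forall m', m' \in msupp r.1.2 -> (m' < r.1.1)%O &
    act_poly b (mpolyX int r.1.1 - r.1.2 - p%:R * r.2) = 0].
  move=> cS; have nf : ~ free_mod p I S.
    move=> /(free_mod_lt p_pr iI Ip (deviation_ann_mod actC p b devA)).
    by rewrite cS ltnn.
  by have [m [L [H ?]]] := lead_relation p_pr nf; exists (m, L, H).
have ex_rel S : exists r : multinom d * ZX d * ZX d, #|S| = k.+1 ->
   [/\ forall i, i \notin S -> r.1.1 i = 0%N,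
    forall m', m' \in msupp r.1.2 -> (m' < r.1.1)%O &
    act_poly b (mpolyX int r.1.1 - r.1.2 - p%:R * r.2) = 0].
  have [/nfree[r ?]|/eqP cS] := eqVneq #|S| k.+1; first by exists r.
  by exists (mnm0, 0, 0).
have [rel relP] := choice ex_rel.
pose D := (\max_(S : {set 'I_d}) \max_(i < d) (rel S).1.1 i).+1.
have D_gt S i : #|S| = k.+1 -> ((rel S).1.1 i < D)%N.
  move=> _; rewrite ltnS; apply: (@leq_trans (\max_(i < d) (rel S).1.1 i)).
    exact: (@leq_bigmax _ (fun i => (rel S).1.1 i) i).
  exact: (@leq_bigmax _ (fun S : {set 'I_d} => \max_(i < d) (rel S).1.1 i)%N S).
have walk_step := @growth_step p p_pr b k.+1 (fun S => (rel S).1.1) (fun S => (rel S).1.2)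
  (fun S => (rel S).2) _ _ _ D k erefl D_gt.
pose D' := (\max_(S : {set 'I_d}) msize (rel S).2).+2.
exists (p * (2 ^ d * D ^ d) + C' * (D'.+1) ^ k)%N => r.
have [||| s ss sP] := walk_step _ _ _ r _ (C'P (r + D')%N).
- by move=> S i /relP[+ _ _]; apply.
- by move=> S m' /relP[_ + _]; apply.
- by move=> S /relP[].
exists s => //; apply: leq_trans ss _.
have leq_exp (x y e : nat) : (x <= y)%N -> (x ^ e <= y ^ e)%N.
  by case: e => // e; rewrite leq_exp2r.
rewrite mulnDl expnD; apply: leq_mul.
  apply: leq_trans (leq_exp _ _ _ (ltnW (ltn_expl p (ltnSn 1)))) _.
  rewrite -expnM leq_exp2l // -mulnA leq_mul2l card_std_exps ?orbT //.
rewrite leq_exp2l // -mulnA leq_mul2l -expnMn; apply/orP; right; apply: leq_exp.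
by rewrite mulSn mulnS -addSn leq_add2l leq_addr.
Qed.

End Growth.

(** * Confining a random walk to a finite set *)

Section BigSupport.
Context {R : nmodType} {T : choiceType}.

Lemma big_support_fsbig (r : seq T) (F : T -> R) : uniq r ->
  (forall x, x \notin r -> F x = 0) -> \sum_(x <- r) F x = \sum_(x \in setT) F x.
Proof.
move=> ur F0; rewrite fsbig_seq //; apply: fsbig_widen => // x [_ /= xr].
by apply: F0; apply/negP.
Qed.

End BigSupport.

Section Bump.
Context {R : realType} {N : nat} (N2 : (2 <= N)%N).

(** The profile (1 - x^2)^2 vanishes to second order at the boundary of the box, so
    that cutting it off does not spoil the inequality of bump1_step near the
    boundary; a profile vanishing to first order would. *)
Definition bump1 (e : int) : R := if `|e| < N%:Z then (1 - (e%:~R / N%:R) ^+ 2) ^+ 2 else 0.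

Lemma bump1_ge0 e : 0 <= bump1 e.
Proof. by rewrite /bump1; case: ifP => // _; exact: sqr_ge0. Qed.

Lemma bump1_le1 e : bump1 e <= 1.
Proof.
rewrite /bump1; case: ifP => // lteN; set x := _ / _.
have N0 : 0 < N%:R :> R by rewrite ltr0n; lia.
have x1 : x <= 1 by rewrite ler_pdivrMr // mul1r -[N%:R]/(N%:Z%:~R) ler_int; lia.
have x_1 : - 1 <= x.
  by rewrite ler_pdivlMr // mulN1r -[N%:R]/(N%:Z%:~R) -intrN ler_int; lia.
have x2 : x ^+ 2 <= 1 by nra.
have x0 : 0 <= x ^+ 2 by exact: sqr_ge0.
nra.
Qed.

Lemma bump1_in e x : (`|e| <= N%:Z) -> x = e%:~R / N%:R -> bump1 e = (1 - x ^+ 2) ^+ 2.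
Proof.
move=> leN ->; rewrite /bump1; case: ifP => // /negbT; rewrite -leNgt => geN.
have -> : (e%:~R / N%:R) ^+ 2 = 1 :> R.
  have N0 : N%:R != 0 :> R by rewrite pnatr_eq0; lia.
  have /eqP : `|e| = N%:Z by lia.
  rewrite eqr_norml => /andP[/orP[]/eqP-> _]; rewrite ?mulrNz ?mulNr ?sqrrN.
    by rewrite -[_%:~R]/(N%:R) divff ?expr1n.
  by rewrite -[_%:~R]/(N%:R) divff ?expr1n.
by rewrite subrr expr0n.
Qed.

Definition decay : R := 1 - 3 / N%:R ^+ 2.

Lemma decay_ge0 : 0 <= decay.
Proof.
have N0 : 0 < N%:R ^+ 2 :> R by rewrite exprn_gt0 // ltr0n; lia.
by rewrite subr_ge0 ler_pdivrMr // mul1r -natrX ler_nat; nia.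
Qed.

(** In the rescaled variable x = e/N the difference of the two sides is
    2 t^2 (1 + t^2 + 3 x^4), where t = 1/N. *)
Lemma bump1_step e : 2 * decay * bump1 e <= bump1 (e + 1) + bump1 (e - 1).
Proof.
have [lte|gee] := ltP `|e| N%:Z; last first.
  by rewrite {1}/bump1 ltNge gee mulr0 addr_ge0 ?bump1_ge0.
have N0 : N%:R != 0 :> R by rewrite pnatr_eq0; lia.
pose x : R := e%:~R / N%:R; pose t : R := N%:R ^-1.
rewrite (@bump1_in e x) //; last by lia.
rewrite (@bump1_in (e + 1) (x + t)); [|lia|by rewrite intrD mulrDl div1r].
rewrite (@bump1_in (e - 1) (x - t)); [|lia|by rewrite intrB mulrBl div1r].
have -> : decay = 1 - 3 * t ^+ 2 by rewrite /decay /t exprVn.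
have t0 : 0 <= t ^+ 2 by exact: sqr_ge0.
have x0 : 0 <= x ^+ 2 by exact: sqr_ge0.
rewrite -subr_ge0.
have -> : (1 - (x + t) ^+ 2) ^+ 2 + (1 - (x - t) ^+ 2) ^+ 2 -
    2 * (1 - 3 * t ^+ 2) * (1 - x ^+ 2) ^+ 2
  = 2 * t ^+ 2 * (t ^+ 2 + 1 + 3 * (x ^+ 2) ^+ 2).
  ring.
nra.
Qed.

Context {d : nat}.
Implicit Types (e : {ffun 'I_d -> int}).

Definition unitv (i : 'I_d) : {ffun 'I_d -> int} := [ffun j => (j == i)%:R].

Definition bump e : R := \prod_j bump1 (e j).

Lemma bump_ge0 e : 0 <= bump e.
Proof. by apply: prodr_ge0 => j _; exact: bump1_ge0. Qed.

Lemma bump_le1 e : bump e <= 1.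
Proof. by apply: prodr_ile1 => j; rewrite bump1_ge0 bump1_le1. Qed.

Lemma bump0 : bump 0 = 1.
Proof.
rewrite /bump big1 // => j _; rewrite ffunE /bump1 normr0.
by rewrite ifT; [rewrite mulr0z mul0r expr0n subr0 expr1n|lia].
Qed.

(** A step in the direction i only changes the factor i of the product. *)
Lemma bump_step i e : 2 * decay * bump e <= bump (e + unitv i) + bump (e - unitv i).
Proof.
have E1 : \prod_(j | j != i) bump1 ((e + unitv i) j) = \prod_(j | j != i) bump1 (e j).
  by apply: eq_bigr => j /negPf ji; rewrite !ffunE ji addr0.
have E2 : \prod_(j | j != i) bump1 ((e - unitv i) j) = \prod_(j | j != i) bump1 (e j).
  by apply: eq_bigr => j /negPf ji; rewrite !ffunE ji subr0.
rewrite /bump [\prod_j bump1 (e j)](bigD1 i) //= [\prod_j bump1 ((e + _) j)](bigD1 i) //=.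
rewrite [\prod_j bump1 ((e - _) j)](bigD1 i) //= E1 E2.
rewrite !ffunE eqxx -mulrDl mulrA; apply: ler_wpM2r; last exact: bump1_step.
by apply: prodr_ge0 => j _; exact: bump1_ge0.
Qed.

End Bump.
Arguments decay : clear implicits.
Arguments bump : clear implicits.

Section Walk.
Context {R : realType} {G : groupType} (mu : G -> R) (s : seq G).
Hypothesis mu_ge0 : forall x, 0 <= mu x.
Hypothesis mu_sym : forall x, mu (x^-1)%g = mu x.
Hypothesis s_uniq : uniq s.
Hypothesis s_supp : forall x, (x \in s) = (mu x != 0).
Hypothesis mu_sum1 : \sum_(x <- s) mu x = 1.
Implicit Types (f : G -> R) (S : seq G).

Definition walk_step f (x : G) : R := \sum_(y <- s) mu y * f (y^-1 * x)%g.

Lemma convolutionE f : convolution mu f = walk_step f.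
Proof.
apply/funext => x; rewrite /walk_step /convolution -(@big_support_fsbig _ _ s) // => y.
by rewrite s_supp negbK => /eqP->; rewrite mul0r.
Qed.

Lemma walk_step_inv f x : walk_step f x = \sum_(y <- s) mu y * f (y * x)%g.
Proof.
have s_inv : perm_eq [seq (y^-1)%g | y <- s] s.
  apply: uniq_perm => //; first by rewrite map_inj_uniq //; exact: invg_inj.
  move=> y; apply/mapP/idP => [[z + ->]|ys]; first by rewrite !s_supp mu_sym.
  by exists (y^-1)%g; rewrite ?invgK // s_supp mu_sym -s_supp.
by rewrite -(perm_big _ s_inv) big_map; apply: eq_bigr => y _; rewrite mu_sym.
Qed.

(** Averaging over each letter and its inverse gives every letter a symmetric step
    in Z^d, even a letter of order two. *)
Lemma walk_step_avg f x :
  walk_step f x = \sum_(y <- s) mu y * ((f (y * x)%g + f (y^-1 * x)%g) / 2).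
Proof.
have -> : walk_step f x =
    (\sum_(y <- s) mu y * f (y * x)%g + \sum_(y <- s) mu y * f (y^-1 * x)%g) / 2.
  by rewrite -walk_step_inv -/(walk_step f x); field.
by rewrite -big_split mulr_suml; apply: eq_bigr => y _ /=; ring.
Qed.

Local Notation delta1 := (fun x : G => (x == 1%g)%:R : R).

Lemma iter_walk_step_ge0 n f : (forall x, 0 <= f x) -> forall x, 0 <= iter n walk_step f x.
Proof.
move=> f0; elim: n => [|n IHn] x //=; apply: sumr_ge0 => y _.
by apply: mulr_ge0 => //; exact: IHn.
Qed.

Lemma walk_step_support f S : exists2 S', uniq S' &
  ((forall x, x \notin S -> f x = 0) -> forall x, x \notin S' -> walk_step f x = 0) /\
  forall y u, y \in s -> u \in S -> (y * u)%g \in S'.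
Proof.
exists (undup [seq (y * u)%g | y <- s, u <- S]); first exact: undup_uniq.
split=> [f0 x|y u ys uS]; last by rewrite mem_undup; apply/allpairsP; exists (y, u).
rewrite mem_undup => xS; rewrite /walk_step big_seq big1 // => y ys.
rewrite f0 ?mulr0 //; apply: contra xS => uS; apply/allpairsP.
by exists (y, (y^-1 * x)%g); split=> //=; rewrite mulVKg.
Qed.

Lemma iter_walk_step_support n : exists2 S, uniq S &
  forall x, x \notin S -> iter n walk_step delta1 x = 0.
Proof.
elim: n => [|n [S uS fS]]; first by exists [:: 1%g] => // x; rewrite inE /= => /negPf->.
have [S' uS' [S'P _]] := walk_step_support (iter n walk_step delta1) S.
by exists S' => //; exact: S'P.
Qed.

(** Transition probabilities are symmetric: starting from 1 and applying the
    operator n times to f, or integrating f against the n-step distribution, is the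
    same. *)
Lemma iter_walk_step_pairing n f S : uniq S -> (forall x, x \notin S -> f x = 0) ->
  iter n walk_step f 1%g = \sum_(x <- S) iter n walk_step delta1 x * f x.
Proof.
elim: n f S => [|n IHn] f S uS f0.
  rewrite /=; have [S1|S1] := boolP (1%g \in S).
    rewrite (bigD1_seq 1%g) //= eqxx mul1r big1 ?addr0 // => x /negPf->.
    by rewrite mul0r.
  by rewrite f0 // big1_seq // => x /andP[_ xS]; case: eqP xS S1 => [->->|]; rewrite ?mul0r.
have [S' uS' [S'f S'in]] := walk_step_support f S.
rewrite iterSr (IHn _ _ uS' (S'f f0)).
under eq_bigr do rewrite /walk_step mulr_sumr.
rewrite exchange_big /=; under [RHS]eq_bigr do rewrite [walk_step _ _]walk_step_inv mulr_suml.
rewrite [RHS]exchange_big /= big_seq [RHS]big_seq; apply: eq_bigr => y ys.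
transitivity (mu y * \sum_(x <- S') iter n walk_step delta1 x * f (y^-1 * x)%g).
  by rewrite mulr_sumr; apply: eq_bigr => x _; rewrite mulrCA.
transitivity (mu y * \sum_(x <- S) iter n walk_step delta1 (y * x)%g * f x); last first.
  by rewrite mulr_sumr; apply: eq_bigr => x _; rewrite mulrA.
congr (_ * _).
transitivity (\sum_(x <- [seq (y * u)%g | u <- S])
    iter n walk_step delta1 x * f (y^-1 * x)%g); last first.
  by rewrite big_map; apply: eq_bigr => u _; rewrite mulKg.
have f0' x : x \notin [seq (y * u)%g | u <- S] -> f (y^-1 * x)%g = 0.
  move=> xS; apply: f0; apply: contra xS => yxS.
  by apply/mapP; exists (y^-1 * x)%g; rewrite ?mulVKg.
rewrite (@big_support_fsbig _ _ S') // => [|x xS]; last first.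
  by rewrite f0' ?mulr0 //; apply: contra xS => /mapP[u uS0 ->]; exact: S'in.
rewrite (@big_support_fsbig _ _ [seq (y * u)%g | u <- S]) // => [|x xS].
- by rewrite map_inj_uniq //; exact: mulgI.
- by rewrite f0' ?mulr0.
Qed.

Lemma return_ge_sum_sqr n S : uniq S ->
  \sum_(x <- S) iter n walk_step delta1 x ^+ 2 <= iter n.*2 walk_step delta1 1%g.
Proof.
move=> uS; have [S1 uS1 S1P] := iter_walk_step_support n.
rewrite -addnn iterD (@iter_walk_step_pairing _ _ (S ++ [seq x <- S1 | x \notin S])).
- rewrite big_cat /= lerDl; apply: sumr_ge0 => x _; exact: sqr_ge0.
- rewrite cat_uniq uS filter_uniq // andbT -all_predC; apply/allP => x.
  by rewrite mem_filter => /andP[].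
- move=> x; rewrite mem_cat negb_or mem_filter negb_and => /andP[xS].
  by rewrite xS; exact: S1P.
Qed.

(** Cauchy-Schwarz: p_2n is the sum of the squares of the n-step distribution,
    which has mass at least q on S. It is used in the form that the variance on S
    of this distribution is nonnegative. *)
Lemma return_prob_ge n S q : uniq S -> 0 <= q ->
  q <= iter n walk_step (fun x => (x \in S)%:R) 1%g -> q ^+ 2 <= (size S)%:R * return_prob mu n.
Proof.
move=> uS q0 qle; set F := iter n walk_step delta1.
have -> : return_prob mu n = iter n.*2 walk_step delta1 1%g.
  rewrite /return_prob /convolution_pow; congr (_ _).
  by elim: n.*2 => //= m ->; rewrite convolutionE.
apply: le_trans (ler_wpM2l (ler0n _ _) (return_ge_sum_sqr n uS)).
move: qle; rewrite (@iter_walk_step_pairing _ _ S) // => [qle|x /negPf->//].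
pose Q := \sum_(x <- S) F x.
have {}qle : q <= Q.
  apply: le_trans qle _; rewrite le_eqVlt; apply/orP; left; apply/eqP.
  by rewrite big_seq [RHS]big_seq; apply: eq_bigr => x ->; rewrite mulr1.
apply: (@le_trans _ _ (Q ^+ 2)); first by rewrite lerXn2r ?nnegrE // (le_trans q0).
have [S0|S0] := posnP (size S); first by rewrite /Q (size0nil S0) !big_nil expr0n mulr0.
have S0' : 0 < (size S)%:R :> R by rewrite ltr0n.
(* The mean of F over S, the optimal constant to subtract. *)
pose c := Q / (size S)%:R.
have : 0 <= \sum_(x <- S) (F x - c) ^+ 2 by apply: sumr_ge0 => x _; exact: sqr_ge0.
have -> : \sum_(x <- S) (F x - c) ^+ 2 = \sum_(x <- S) F x ^+ 2 - 2 * c * Q + c ^+ 2 * (size S)%:R.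
  rewrite /Q mulr_sumr -sumrB -[X in _ + X](_ : \sum_(x <- S) c ^+ 2 = _); last first.
    by rewrite big_const_seq count_predT iter_addr addr0 mulr_natr.
  by rewrite -big_split; apply: eq_bigr => x _ /=; ring.
rewrite -(pmulr_rge0 _ S0').
have -> : (size S)%:R * (\sum_(x <- S) F x ^+ 2 - 2 * c * Q + c ^+ 2 * (size S)%:R) =
  (size S)%:R * \sum_(x <- S) F x ^+ 2 - Q ^+ 2.
  by rewrite /c; field; rewrite gt_eqF.
by rewrite subr_ge0.
Qed.

Section Confinement.
Context {N : nat} (N2 : (2 <= N)%N).
Local Notation d := (size s).
Local Notation g i := (nth 1%g s i).
Implicit Types (e : {ffun 'I_d -> int}).
Local Notation decay := (decay R N).
Local Notation bump := (bump R N d).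

(** The walk is compared with the walk of the exponent vectors killed outside the
    box. The bump is at most the indicator of the box, and by bump_step one step of
    the killed walk multiplies it by at least decay. *)
Lemma confinement (w : {ffun 'I_d -> int} -> G) (H : set G) S :
    (forall e (i : 'I_d) h, (forall j, `|e j| < N%:Z) -> H h ->
      (exists2 h', H h' & (g i * (w e * h) = w (e + unitv i) * h')%g) /\
      (exists2 h', H h' & ((g i)^-1 * (w e * h) = w (e - unitv i) * h')%g)) ->
    (forall e h, (forall j, `|e j| < N%:Z) -> H h -> (w e * h)%g \in S) ->
  forall n e h, H h ->
    decay ^+ n * bump e <= iter n walk_step (fun x => (x \in S)%:R) (w e * h)%g.
Proof.
move=> wstep wS n e h Hh.
(* Outside the box the bump is zero and there is nothing to prove. *)
have out e' n' h' : ~ (forall j, `|e' j| < N%:Z) ->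
    decay ^+ n' * bump e' <= iter n' walk_step (fun x => (x \in S)%:R) (w e' * h')%g.
  move=> /existsNP[j /negP ltj]; rewrite /bump (bigD1 j) //= {1}/bump1 (negPf ltj).
  by rewrite mul0r mulr0; apply: iter_walk_step_ge0 => x; exact: ler0n.
elim: n e h Hh => [|n IHn] e h Hh; have [ein|/out//] := pselect (forall j, `|e j| < N%:Z).
  by rewrite expr0 mul1r /= wS // bump_le1.
rewrite iterS walk_step_avg (big_nth 1%g) big_mkord.
apply: (@le_trans _ _ (\sum_(i < d) mu (g i) *
    (decay ^+ n * ((bump (e + unitv i) + bump (e - unitv i)) / 2)))).
  apply: (@le_trans _ _ (\sum_(i < d) mu (g i) * (decay ^+ n.+1 * bump e))).
    rewrite -mulr_suml -[leLHS]mul1r; apply: ler_wpM2r.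
      by rewrite mulr_ge0 ?bump_ge0 // exprn_ge0 ?decay_ge0.
    by rewrite -{1}mu_sum1 (big_nth 1%g) big_mkord.
  apply: ler_sum => i _; apply: ler_wpM2l => //; rewrite exprSr -mulrA.
  apply: ler_wpM2l; first by rewrite exprn_ge0 ?decay_ge0.
  by rewrite ler_pdivlMr // mulrC mulrA bump_step.
apply: ler_sum => i _; apply: ler_wpM2l => //.
have [[h1 H1 ->] [h2 H2 ->]] := wstep e i h ein Hh.
rewrite mulrA; apply: ler_wpM2r; first by rewrite invr_ge0.
by rewrite mulrDr; apply: lerD; exact: IHn.
Qed.

End Confinement.
End Walk.

(** * The derived subgroup of a metabelian group as a module *)

Section Subgroups.
Context {G : groupType}.
Implicit Types (H S : set G).

Lemma subgroupE H : subgroup H <-> H 1%g /\ forall x y, H x -> H y -> H (x / y)%g.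
Proof.
rewrite /subgroup; split=> -[H1 HD].
  by split=> [|x y /mem_set Hx /mem_set Hy]; [exact/set_mem|apply/set_mem/HD].
split; first exact/mem_set.
by move=> x y /set_mem Hx /set_mem Hy; apply/mem_set/HD.
Qed.

Lemma generated_subgroup S : subgroup (generated S).
Proof.
apply/subgroupE; split=> [M [/subgroupE[M1 _]] //|x y Sx Sy M MP].
by have [/subgroupE[_ MD] _] := MP; apply: MD; [exact: Sx|exact: Sy].
Qed.

Lemma derived_subgroup_comm (x y : G) : derived_subgroup G [~ x, y]%g.
Proof. by move=> M [_]; apply; exists x => //; exists y. Qed.

Lemma derived_subgroup_conj (x g : G) :
  derived_subgroup G x -> derived_subgroup G (x ^ g)%g.
Proof.
move=> Dx; have [D1 DD] := (subgroupE _).1 (generated_subgroup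
  [set [~ x, y]%g | x in [set: G] & y in setT]).
apply: (Dx [set x | derived_subgroup G (x ^ g)%g]); split.
  apply/subgroupE; split=> /= [|y z Dy Dz]; first by rewrite conj1g.
  by rewrite conjMg conjVg; exact: DD.
by move=> _ [y _ [z _ <-]] /=; rewrite conjRg; exact: derived_subgroup_comm.
Qed.

End Subgroups.

(** The derived subgroup as a type, which carries an additive group structure
    because of the hypothesis metaG. *)
Definition derived_zmod (G : groupType) (metaG : metabelian G) : Type :=
  {x : G | `[< derived_subgroup G x >]}.

Section DerivedZmod.
Context {G : groupType} (metaG : metabelian G).
Local Notation A := (derived_zmod metaG).

HB.instance Definition _ := Choice.on A.

Definition dval (a : A) : G := val a.

Lemma dvalP a : derived_subgroup G (dval a).
Proof. by apply/asboolP; exact: (valP a). Qed.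

Lemma dval_inj : injective dval. Proof. exact: val_inj. Qed.

Definition dsub (x : G) (Dx : derived_subgroup G x) : A := exist _ x (asboolT Dx).

Let derivedP := (subgroupE _).1 (generated_subgroup [set [~ x, y]%g | x in [set: G] & y in setT]).

Let D1 : derived_subgroup G 1%g. Proof. by have [] := derivedP. Qed.
Let DV x : derived_subgroup G x -> derived_subgroup G x^-1%g.
Proof. by move=> Dx; have [_ DD] := derivedP; rewrite -[_^-1%g]mul1g; exact: DD. Qed.
Let DM x y : derived_subgroup G x -> derived_subgroup G y -> derived_subgroup G (x * y)%g.
Proof. by move=> Dx /DV Dy; have [_ DD] := derivedP; rewrite -[y]invgK; exact: DD. Qed.

Definition dzero : A := dsub D1.
Definition dopp (a : A) : A := dsub (DV (dvalP a)).
Definition dadd (a b : A) : A := dsub (DM (dvalP a) (dvalP b)).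

Lemma daddA : associative dadd.
Proof. by move=> a b c; apply: dval_inj; exact: mulgA. Qed.
Lemma daddC : commutative dadd.
Proof. by move=> a b; apply: dval_inj; apply: metaG; exact: dvalP. Qed.
Lemma dadd0 : left_id dzero dadd.
Proof. by move=> a; apply: dval_inj; exact: mul1g. Qed.
Lemma daddN : left_inverse dzero dopp dadd.
Proof. by move=> a; apply: dval_inj; exact: mulVg. Qed.

HB.instance Definition _ := GRing.isZmodule.Build A daddA daddC dadd0 daddN.

Lemma dvalD a b : dval (a + b) = (dval a * dval b)%g. Proof. by []. Qed.
Lemma dvalB a b : dval (a - b) = (dval a / dval b)%g. Proof. by []. Qed.

Lemma dvalMn a n : dval (a *+ n) = (dval a ^+ n)%g.
Proof. by elim: n => [|n IHn]; rewrite ?mulr0n // mulrS expgS dvalD IHn. Qed.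

Definition dconj (g : G) (a : A) : A := dsub (derived_subgroup_conj g (dvalP a)).

Lemma dvalJ g a : dval (dconj g a) = (dval a ^ g)%g. Proof. by []. Qed.

Lemma dconjB g : {morph dconj g : a b / a - b}.
Proof. by move=> a b; apply: dval_inj; rewrite dvalB !dvalJ conjMg conjVg. Qed.

HB.instance Definition _ g := GRing.isZmodMorphism.Build _ _ (dconj g) (dconjB g).

(** Two conjugations differ by the conjugation by a commutator, which is trivial on
    the abelian derived subgroup. *)
Lemma dconjC g h a : dconj g (dconj h a) = dconj h (dconj g a).
Proof.
apply: dval_inj; rewrite !dvalJ -!conjgM.
have -> : (h * g = g * h * [~ h, g])%g by rewrite -commgC.
rewrite conjgM [LHS]conjgE (metaG (y := [~ h, g]%g)) ?mulKg //.
  exact: dvalP (dconj (g * h)%g a).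
exact: derived_subgroup_comm.
Qed.

End DerivedZmod.

Section Letters.
Context {G : groupType} (metaG : metabelian G) (s : seq G).
Hypothesis sV : forall y, y \in s -> (y^-1)%g \in s.
Local Notation A := (derived_zmod metaG).
Local Notation d := (size s).
Local Notation g i := (nth 1%g s i).

Definition letter_act (i : 'I_d) : {additive A -> A} := dconj (g i).

Lemma letter_actC (i j : 'I_d) a : letter_act i (letter_act j a) = letter_act j (letter_act i a).
Proof. exact: dconjC. Qed.

Lemma letterP y : y \in s -> exists i : 'I_d, y = g i.
Proof.
move=> ys; have lti : (index y s < d)%N by rewrite index_mem.
by exists (Ordinal lti); rewrite nth_index.
Qed.

(** A subset of the derived subgroup stable under conjugation by the letters is
    stable under conjugation by the group that they generate, as the letters are
    closed under inversion. *)
Lemma deviation_submodule n : generated [set` s] = setT ->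
  deviation_lt n [set N : set G | normal_subgroup N] ->
  deviation_lt n [set N : set A | is_submodule letter_act N].
Proof.
move=> gens; pose f (N : set A) : set G := [set dval a | a in N].
apply: (@deviation_lt_homo _ _ _ _ f) => [N [N0 NB Nact]|N N' _ _|N N' _ _].
- split.
    apply/subgroupE; split; first by exists 0.
    by move=> _ _ [a Na <-] [b Nb <-]; exists (a - b); [exact: NB|].
  move=> x h; have : generated [set` s] h by rewrite gens.
  pose H := [set h | forall x, f N x -> f N (x ^ h)%g /\ f N (x ^ h^-1)%g].
  move=> /(_ H) hH fx; apply: (hH _ x fx).1; split.
    apply/subgroupE; split=> [y Ny|y z Hy Hz t Nt]; first by rewrite invg1 conjg1.
    rewrite invgF !conjgM; split.
      by apply: (Hz _ _).2; exact: (Hy _ _).1.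
    by apply: (Hy _ _).2; exact: (Hz _ _).1.
  have stab z : z \in s -> forall y, f N y -> f N (y ^ z)%g.
    move=> /letterP[i ->] _ [a Na <-]; exists (letter_act i a); [exact: Nact|].
    exact: dvalJ.
  by move=> z zs y Ny; split; apply: stab => //; exact: sV.
- by move=> /subsetPset NN'; apply/subsetPset => _ [a /NN' N'a <-]; exists a.
- move=> /subsetPset NN' E; apply/seteqP; split=> // a N'a.
  have : f N (dval a) by rewrite E; exists a.
  by move=> [b Nb /dval_inj <-].
Qed.

Local Notation cidx := ('I_d * 'I_d)%type.

Definition dcomm (x y : G) : A := dsub metaG (derived_subgroup_comm x y).

(** The monomials of degree at most L in F are the conjugations by products of at
    most L letters. *)
Definition comm_ball L : set A :=
  [set a | exists F : cidx -> ZX d, (forall k, (msize (F k) <= L.+1)%N) /\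
     a = \sum_(k : cidx) act_poly letter_act (dcomm (g k.1) (g k.2)) (F k)].

Lemma comm_ball0 L : comm_ball L 0.
Proof.
exists (fun=> 0); split=> [k|]; first by rewrite mmeasure0.
by rewrite big1 // => k _; exact: raddf0.
Qed.

Lemma comm_ballB L a b : comm_ball L a -> comm_ball L b -> comm_ball L (a - b).
Proof.
move=> [F [sF ->]] [F' [sF' ->]]; exists (fun k => F k - F' k); split=> [k|].
  by apply: leq_trans (mmeasureD_le _ _ _) _; rewrite mmeasureN geq_max sF sF'.
by rewrite -sumrB; apply: eq_bigr => k _; rewrite raddfB.
Qed.

Lemma comm_ballD L a b : comm_ball L a -> comm_ball L b -> comm_ball L (a + b).
Proof.
move=> La Lb; rewrite -[b]opprK; apply: comm_ballB => //; rewrite -sub0r.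
by apply: comm_ballB => //; exact: comm_ball0.
Qed.

Lemma comm_ball_le L L' a : (L <= L')%N -> comm_ball L a -> comm_ball L' a.
Proof.
move=> LL' [F [sF aE]]; exists F; split=> // k.
by apply: leq_trans (sF k) _; rewrite ltnS.
Qed.

Lemma msize_var_mul (i : 'I_d) (F : ZX d) : (msize (var i * F) <= (msize F).+1)%N.
Proof.
have [->|F0] := eqVneq F 0; first by rewrite mulr0 mmeasure0.
rewrite msizeM // ?msizeX ?mdeg1 //.
by apply/eqP => /(congr1 (mcoeff (mnm1 i))); rewrite mcoeffX eqxx mcoeff0.
Qed.

Lemma comm_ball_act L (i : 'I_d) a : comm_ball L a -> comm_ball L.+1 (letter_act i a).
Proof.
move=> [F [sF ->]]; exists (fun k => var i * F k); split=> [k|].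
  by apply: leq_trans (msize_var_mul _ _) _; rewrite ltnS.
rewrite raddf_sum; apply: eq_bigr => k _; rewrite act_poly_var //; exact: letter_actC.
Qed.

Lemma comm_ball_comm (i j : 'I_d) : comm_ball 0 (dcomm (g i) (g j)).
Proof.
exists (fun k => (k == (i, j))%:R); split=> [k|].
  by case: eqP => _; rewrite ?mmeasure0 // msize1.
rewrite (bigD1 (i, j)) //= eqxx act_poly1 big1 ?addr0 // => k /negPf->.
exact: raddf0.
Qed.

Definition comm_ball_grp L : set G := [set dval a | a in comm_ball L].

Lemma comm_ball_grp1 L : comm_ball_grp L 1%g. Proof. by exists 0; [exact: comm_ball0|]. Qed.

Lemma comm_ball_grpM L x y : comm_ball_grp L x -> comm_ball_grp L y -> comm_ball_grp L (x * y)%g.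
Proof. by move=> [a La <-] [b Lb <-]; exists (a + b); [exact: comm_ballD|]. Qed.

Lemma comm_ball_grp_le L L' x : (L <= L')%N -> comm_ball_grp L x -> comm_ball_grp L' x.
Proof. by move=> LL' [a La <-]; exists a => //; exact: comm_ball_le La. Qed.

Lemma comm_ball_grpJ L x y : y \in s -> comm_ball_grp L x -> comm_ball_grp L.+1 (x ^ y)%g.
Proof. by move=> /letterP[i ->] [a La <-]; exists (letter_act i a); [exact: comm_ball_act|]. Qed.

Lemma comm_ball_grpJX L x y n : y \in s -> comm_ball_grp L x ->
  comm_ball_grp (L + n) (x ^ (y ^+ n))%g.
Proof.
move=> ys; elim: n => [|n IHn] Lx; first by rewrite addn0 expg0 conjg1.
by rewrite expgSr conjgM addnS; apply: comm_ball_grpJ => //; exact: IHn.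
Qed.

Lemma comm_ball_grp_comm y z : y \in s -> z \in s -> comm_ball_grp 0 [~ y, z]%g.
Proof.
move=> /letterP[i ->] /letterP[j ->].
by exists (dcomm (g i) (g j)); [exact: comm_ball_comm|].
Qed.

(** By induction from [y, z^(n+1)] = [y, z] [y, z^n]^z; each conjugation costs one
    degree. *)
Lemma comm_ball_grp_commX y z n : y \in s -> z \in s -> comm_ball_grp n [~ y, z ^+ n]%g.
Proof.
move=> ys zs; elim: n => [|n IHn]; first by rewrite expg0 commg1; exact: comm_ball_grp1.
have -> : ([~ y, z ^+ n.+1] = [~ y, z] * [~ y, z ^+ n] ^ z)%g.
  by rewrite expgSr !commgEl conjMg conjVg conjgM -[RHS]mulgA mulVKg.
apply: comm_ball_grpM; first by apply: comm_ball_grp_le (comm_ball_grp_comm ys zs).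
exact: comm_ball_grpJ.
Qed.

Definition zpow (z : G) (n : int) : G :=
  match n with Posz k => (z ^+ k)%g | Negz k => (z^-1 ^+ k.+1)%g end.

Lemma zpowD1 z n : (z * zpow z n = zpow z (n + 1))%g.
Proof.
case: n => k; first by rewrite -PoszD addn1 /= expgS.
rewrite /= expgS mulVKg; case: k => [|k]; first by [].
by have -> : Negz k.+1 + 1 = Negz k by lia.
Qed.

Lemma zpowB1 z n : (z^-1 * zpow z n = zpow z (n - 1))%g.
Proof.
case: n => [[|k]|k].
- by rewrite [LHS]mulg1.
- have -> : Posz k.+1 - 1 = Posz k by lia.
  by rewrite [zpow z k.+1]expgS mulKg.
- have -> : Negz k - 1 = Negz k.+1 by lia.
  by rewrite /= [in RHS]expgS.
Qed.

Lemma zpow_letter z n : z \in s -> exists2 z', z' \in s & zpow z n = (z' ^+ absz n)%g.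
Proof.
by case: n => k zs; [exists z|exists (z^-1)%g => //; exact: sV].
Qed.

Implicit Types (e : {ffun 'I_d -> int}).

Definition normal_word (l : seq 'I_d) e : G :=
  foldr (fun (i : 'I_d) x => zpow (g i) (e i) * x)%g 1%g l.

Lemma comm_ball_grpJ_word N L l e x : (forall j, absz (e j) <= N)%N -> comm_ball_grp L x ->
  comm_ball_grp (L + N * size l) (x ^ normal_word l e)%g.
Proof.
move=> eN; elim: l L x => [|j l IHl] L x Lx; first by rewrite muln0 addn0 conjg1.
have gs : g j \in s by exact: mem_nth.
rewrite /= conjgM mulnS addnA; apply: IHl.
have [z zs ->] := zpow_letter (e j) gs.
by apply: comm_ball_grp_le (comm_ball_grpJX _ zs Lx); rewrite leq_add2l.
Qed.

(** Moving y through the word from the left creates at each syllable z a commutator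
    [y, z], which is then conjugated through the rest of the word. The letter y
    stops at the syllable of its own generator g i, which may be a power of y or
    of the inverse of y. *)
Lemma letter_normal_word N (i : 'I_d) y l e e' : y \in s ->
    (forall j, absz (e j) <= N)%N -> (forall j, j != i -> e' j = e j) ->
    (y * zpow (g i) (e i) = zpow (g i) (e' i))%g -> uniq l -> i \in l ->
  exists2 h, comm_ball_grp (N * size l) h & (y * normal_word l e = normal_word l e' * h)%g.
Proof.
move=> ys eN e'E ye; elim: l => //= j l IHl /andP[jl ul].
rewrite in_cons; case: eqVneq => [ij _|ij il].
  subst j; exists 1%g; first exact: comm_ball_grp1.
  rewrite mulg1 mulgA ye; congr (_ * _)%g.
  elim: l jl {IHl ul} => //= k l IHl; rewrite in_cons negb_or => /andP[ik il].
  by rewrite IHl // e'E // eq_sym.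
have [h hN hE] := IHl ul il.
have gs : g j \in s by exact: mem_nth.
set z := zpow _ _; exists (h * ([~ y, z] ^ normal_word l e))%g.
  apply: comm_ball_grpM; first by apply: comm_ball_grp_le hN; rewrite leq_mul.
  rewrite mulnS; apply: comm_ball_grpJ_word => //.
  rewrite /z; have [z' zs ->] := zpow_letter (e j) gs.
  by apply: comm_ball_grp_le (comm_ball_grp_commX _ ys zs).
rewrite e'E 1?eq_sym // -/z.
have cW := conjgC [~ y, z]%g (normal_word l e).
have yz := commgC y z.
move: ([~ y, z]%g) cW yz => c; move: (c ^ _)%g => c' cW yz.
by rewrite mulgA yz -mulgA cW !mulgA -[(z * y * _)%g]mulgA hE !mulgA.
Qed.

End Letters.

(** * Return probability in terms of the size of a box *)

Lemma coverable_sum (I : eqType) (A : zmodType) (r : seq I) (X : I -> set A) (N : I -> nat) :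
  (forall k, coverable (X k) (N k)) ->
  coverable [set a | exists x : I -> A, (forall k, X k (x k)) /\ a = \sum_(k <- r) x k]
    (\prod_(k <- r) N k).
Proof.
move=> cX; elim: r => [|k r [t st tP]].
  by exists [:: 0]; rewrite ?big_nil // => _ [x [_ ->]]; rewrite big_nil inE.
have [u su uP] := cX k; exists [seq a + b | a <- u, b <- t].
  by rewrite size_allpairs big_cons leq_mul.
move=> _ [x [xX ->]]; rewrite big_cons; apply/allpairsP.
exists (x k, \sum_(j <- r) x j); split => //=; first exact: uP.
by apply: tP; exists x.
Qed.

Section Assembly.
Context {R : realType} {G : groupType} (metaG : metabelian G) (k : nat).
Context (mu : G -> R) (s : seq G).
Hypothesis mu_ge0 : forall x, 0 <= mu x.
Hypothesis mu_sym : forall x, mu (x^-1)%g = mu x.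
Hypothesis s_uniq : uniq s.
Hypothesis s_supp : forall x, (x \in s) = (mu x != 0).
Hypothesis mu_sum1 : \sum_(x <- s) mu x = 1.
Hypothesis s_gen : generated [set` s] = setT.
Hypothesis torG : torsion (derived_subgroup G).
Hypothesis devG : deviation_lt k.+1 [set N : set G | normal_subgroup N].
Local Notation d := (size s).
Local Notation g i := (nth 1%g s i).

Let sV y : y \in s -> (y^-1)%g \in s.
Proof. by rewrite !s_supp mu_sym. Qed.

(** The ball is a sum of one ball for each of the finitely many commutators of
    letters, which have finite order. *)
Lemma coverable_comm_ball :
  exists C, forall L, coverable (comm_ball (metaG := metaG) s L) (2 ^ (C * L.+1 ^ k)).
Proof.
pose act := letter_act metaG (s := s).
pose cc (ij : 'I_d * 'I_d) := dcomm metaG (g ij.1) (g ij.2).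
have growth ij : exists C, forall r, coverable (orbit_ball act (cc ij) r) (2 ^ (C * r.+1 ^ k)).
  have [n n0 cn] := torG (derived_subgroup_comm (g ij.1) (g ij.2)).
  apply: (module_growth (letter_actC (s := s)) _ n0).
    exact: deviation_submodule.
  by apply: dval_inj; rewrite dvalMn.
have [C CP] := choice growth.
exists (\sum_ij C ij)%N => L.
have [t st tP] := coverable_sum (index_enum ('I_d * 'I_d)%type) (fun ij => CP ij L).
exists t; first by rewrite big_distrl /= expn_sum.
move=> a [F [sF ->]]; apply: tP; exists (fun ij => act_poly act (cc ij) (F ij)).
by split=> // ij; exists (F ij) => //; exact: sF.
Qed.

(** The set S of the confinement consists of all w(e) h with e in the box of side N
    and h in a commutator ball of radius Nd, the bound of letter_normal_word for
    words with d syllables of length at most N. This ball is a subgroup, so that the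
    steps of the walk stay inside it. *)
Lemma return_prob_lower : exists C, forall N n, (2 <= N)%N ->
  decay R N ^+ n.*2 <=
  ((N.*2.+1 ^ d * 2 ^ (C * (N * d).+1 ^ k))%N)%:R * return_prob mu n.
Proof.
have [C CP] := coverable_comm_ball; exists C => N n N2.
set L := (N * d)%N; have [t st tP] := CP L.
pose w := normal_word (s := s) (enum 'I_d).
pose box (f : {ffun 'I_d -> 'I_N.*2.+1}) : {ffun 'I_d -> int} := [ffun j => (f j)%:Z - N%:Z].
pose S := undup [seq (w (box f) * dval a)%g | f <- enum {: {ffun 'I_d -> 'I_N.*2.+1}}, a <- t].
have sizeS : (size S <= N.*2.+1 ^ d * 2 ^ (C * L.+1 ^ k))%N.
  apply: leq_trans (size_undup _) _; rewrite size_allpairs leq_mul //.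
  by rewrite -cardE card_ffun !card_ord.
have wS (e : {ffun 'I_d -> int}) h :
    (forall j, `|e j| < N%:Z) -> comm_ball_grp metaG s L h -> (w e * h)%g \in S.
  move=> eN [a La <-]; rewrite mem_undup; apply/allpairsP.
  pose f : {ffun 'I_d -> 'I_N.*2.+1} := [ffun j => inord (absz (e j + N%:Z))].
  exists (f, a); split; [by rewrite mem_enum|exact: tP|congr (w _ * _)%g].
  apply/ffunP => j; rewrite !ffunE /= inordK; have := eN j; lia.
have wstep (e : {ffun 'I_d -> int}) (i : 'I_d) h :
    (forall j, `|e j| < N%:Z) -> comm_ball_grp metaG s L h ->
   (exists2 h', comm_ball_grp metaG s L h' & (g i * (w e * h) = w (e + unitv i) * h')%g) /\
   (exists2 h', comm_ball_grp metaG s L h' & ((g i)^-1 * (w e * h) = w (e - unitv i) * h')%g).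
  move=> eN Lh; have gs : g i \in s by exact: mem_nth.
  have eN' j : (absz (e j) <= N)%N by have := eN j; lia.
  have E y (e' : {ffun 'I_d -> int}) : y \in s -> (forall j, j != i -> e' j = e j) ->
      (y * zpow (g i) (e i) = zpow (g i) (e' i))%g ->
      exists2 h', comm_ball_grp metaG s L h' & (y * (w e * h) = w e' * h')%g.
    move=> ys e'E ye.
    have [h' Lh' hE] := letter_normal_word metaG sV ys eN' e'E ye (enum_uniq 'I_d) (mem_enum _ i).
    exists (h' * h)%g; last by rewrite !mulgA hE.
    by apply: comm_ball_grpM => //; move: Lh'; rewrite size_enum_ord.
  split; apply: E => //.
  - by move=> j /negPf ji; rewrite !ffunE ji addr0.
  - by rewrite !ffunE eqxx zpowD1.
  - exact: sV.
  - by move=> j /negPf ji; rewrite !ffunE ji subr0.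
  - by rewrite !ffunE eqxx zpowB1.
have conf := confinement mu_ge0 mu_sym s_uniq s_supp mu_sum1 N2 wstep wS n 0 (comm_ball_grp1 _ _ _).
have w01 : (w 0 * 1 = 1)%g.
  rewrite mulg1 /w; elim: (enum _) => //= j l ->; rewrite mulg1 ffunE //.
rewrite w01 bump0 ?mulr1 // in conf.
have dec0 : 0 <= decay R N ^+ n by apply: exprn_ge0; exact: decay_ge0.
have := return_prob_ge mu_sym s_uniq s_supp (undup_uniq _) dec0 conf.
rewrite -exprM muln2 => /le_trans; apply; apply: ler_wpM2r; last by rewrite ler_nat.
rewrite /return_prob /convolution_pow.
rewrite (_ : convolution mu = walk_step mu s); last by apply/funext => f; exact: convolutionE.
by apply: iter_walk_step_ge0 => // x; exact: ler0n.
Qed.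

End Assembly.

(** From 1/(1-u) <= 1 + 4u <= exp(4u) for 0 <= u <= 3/4, which applies to
    u = 3/N^2 as N >= 2. *)
Lemma decay_lower (R : realType) (N n : nat) (x : R) : (2 <= N)%N -> 0 < x -> x <= N%:R ->
  expR (- (24 * n%:R / x ^+ 2)) <= decay R N ^+ n.*2.
Proof.
move=> N2 x0 xN; rewrite /decay.
have N0 : 0 < N%:R ^+ 2 :> R by rewrite exprn_gt0 // ltr0n; lia.
have N4 : 4 <= N%:R ^+ 2 :> R by rewrite -natrX ler_nat; nia.
set u : R := 3 / N%:R ^+ 2.
have u0 : 0 < u by rewrite divr_gt0.
have u1 : u <= 3 / 4 by rewrite ler_pM2l // lef_pV2 ?posrE.
have ux : u <= 3 / x ^+ 2.
  rewrite ler_pM2l // lef_pV2 ?posrE //; last exact: exprn_gt0.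
  by apply: lerXn2r; rewrite ?nnegrE ?ler0n // ltW.
have le_exp : expR (- (4 * u)) <= 1 - u.
  have u1' : 0 < 1 - u by lra.
  rewrite expRN -[leRHS]invrK lef_pV2 ?posrE ?expR_gt0 ?invr_gt0 //.
  apply: le_trans (expR_ge1Dx _).
  rewrite -[_^-1]mul1r ler_pdivrMr //; nra.
apply: (@le_trans _ _ (expR (- (4 * u)) ^+ n.*2)); last first.
  by apply: lerXn2r; rewrite ?nnegrE ?expR_ge0 //; lra.
rewrite -expRM_natl ler_expR mulrN lerN2 -muln2 natrM.
have n0 : 0 <= n%:R :> R by exact: ler0n.
have -> : 24 * n%:R / x ^+ 2 = n%:R * 2 * (4 * (3 / x ^+ 2)) by field; rewrite gt_eqF.
by rewrite ler_wpM2l ?mulr_ge0 // ler_pM2l.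
Qed.

(** * The choice of the box *)

(** The commutator ball dominates the box, which contributes only exp(O(x)),
    because k >= 1. *)
Lemma entropy_upper (R : realType) (d k C N : nat) (x : R) : (1 <= k)%N -> 1 <= x ->
  N%:R <= 3 * x ->
  ((N.*2.+1 ^ d * 2 ^ (C * (N * d).+1 ^ k))%N)%:R <=
    expR ((6 * d + C * (3 * d + 1) ^ k)%N%:R * x ^+ k).
Proof.
move=> k1 x1 Nx; have x0 : 0 <= x by lra.
have xk : x <= x ^+ k by rewrite -{1}[x]expr1; apply: ler_weXn2l.
rewrite natrM natrD mulrDl expRD; apply: ler_pM; rewrite ?ler0n //.
  apply: (@le_trans _ _ (expR (2 * N%:R) ^+ d)).
    rewrite natrX; apply: lerXn2r; rewrite ?nnegrE ?ler0n ?expR_ge0 //.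
    by apply: le_trans (expR_ge1Dx _); rewrite -muln2 -addn1 natrD natrM; lra.
  rewrite -expRM_natl ler_expR natrM.
  have d0 : 0 <= d%:R :> R by exact: ler0n.
  apply: (@le_trans _ _ (d%:R * (2 * (3 * x)))).
    by apply: ler_wpM2l => //; rewrite ler_pM2l.
  have -> : 6 * d%:R * x ^+ k = d%:R * (2 * (3 * x ^+ k)) by ring.
  by apply: ler_wpM2l => //; rewrite !ler_pM2l.
apply: (@le_trans _ _ (expR 1 ^+ (C * (N * d).+1 ^ k))).
  rewrite natrX; apply: lerXn2r; rewrite ?nnegrE ?ler0n ?expR_ge0 //.
  by apply: le_trans (expR_ge1Dx _); lra.
rewrite -expRM_natl ler_expR mulr1 !natrM !natrX -mulrA -exprMn.
apply: ler_wpM2l; first exact: ler0n.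
apply: lerXn2r; rewrite ?nnegrE ?ler0n ?mulr_ge0 ?ler0n //.
have d0 : 0 <= d%:R :> R by exact: ler0n.
rewrite -addn1 !natrD !natrM; nra.
Qed.

Theorem theorem2 (R : realType) (G : groupType) (k : nat)
    (fgG : finitely_generated G) (metaG : metabelian G)
    (dimG : has_krull_dim G k) (k_ge1 : (1 <= k)%N)
    (torG : torsion (derived_subgroup G))
    (mu : G -> R) (mu_walk : walk_measure mu) :
  asym_le (fun n : nat => expR (- (n%:R `^ (k%:R / (k + 2)%:R))))
          (return_prob mu).
Proof.
have [mu_ge0 mu_fin mu_sum mu_sym mu_gen] := mu_walk.
have [s0 s0E] := (finite_seqP _).1 mu_fin.
pose s := undup s0; have s_uniq : uniq s := undup_uniq s0.
have s_supp x : (x \in s) = (mu x != 0).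
  have E : (mu x != 0 : Prop) = (x \in s0) := congr1 (fun A : set G => A x) s0E.
  by rewrite mem_undup; apply/idP/idP; rewrite E.
have s_gen : generated [set` s] = setT.
  by rewrite -mu_gen; congr generated; apply/seteqP; split=> x /=; rewrite s_supp.
have mu_sum1 : \sum_(x <- s) mu x = 1.
  by rewrite big_support_fsbig // => x; rewrite s_supp negbK => /eqP.
have devG : deviation_lt k.+1 [set N : set G | normal_subgroup N] by right.
have [C CP] := return_prob_lower metaG mu_ge0 mu_sym s_uniq s_supp mu_sum1 s_gen torG devG.
pose d := size s; pose K1 := (6 * d + C * (3 * d + 1) ^ k)%N; pose K := (24 + K1)%N.
(* The power 3 is large enough because 3k/(k+2) >= 1 for k >= 1. *)
exists 1, (K ^ 3)%N; split; [exact: ltr01|by rewrite expn_gt0|move=> n n0].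
rewrite mul1r; pose b : R := k%:R / (k + 2)%:R.
have k2 : 0 < (k + 2)%:R :> R by rewrite ltr0n addn2.
(* The side of the box is of order x, which balances the confinement cost n/x^2
   and the entropy x^k. *)
pose x : R := n%:R `^ (k + 2)%:R^-1.
have n1 : 1 <= n%:R :> R by rewrite ler1n.
have x1 : 1 <= x by rewrite -(powRr0 n%:R); apply: ler_powR => //; rewrite invr_ge0 ltW.
have x0 : 0 < x by lra.
have xk : x ^+ k = n%:R `^ b.
  by rewrite -powR_mulrn ?ltW // -powRrM mulrC.
have xk2 : x ^+ (k + 2) = n%:R.
  by rewrite -powR_mulrn ?ltW // -powRrM mulVf ?gt_eqF // powRr1 // ler0n.
pose N := (Num.truncn x).+2.
have N2 : (2 <= N)%N by [].
have /andP[trx xtr] : (Num.truncn x)%:R <= x < (Num.truncn x).+1%:R.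
  by apply: truncn_itv; exact: ltW.
have xN : x <= N%:R by apply: le_trans (ltW xtr) _; rewrite ler_nat.
have Nx : N%:R <= 3 * x by rewrite /N -addn2 natrD; lra.
have low := CP N n N2.
have dec := decay_lower n N2 x0 xN.
have nx : 24 * n%:R / x ^+ 2 = 24 * x ^+ k.
  by rewrite -xk2 exprD; field; rewrite gt_eqF.
have ent := entropy_upper d C k_ge1 x1 Nx.
have lower : expR (- (K%:R * x ^+ k)) <= return_prob mu n.
  have -> : - (K%:R * x ^+ k) = - (24 * n%:R / x ^+ 2) - K1%:R * x ^+ k.
    by rewrite nx /K natrD; ring.
  rewrite expRD expRN ler_pdivrMr ?expR_gt0 //.
  apply: le_trans dec (le_trans low _); rewrite mulrC; apply: ler_wpM2l ent.
  rewrite -(pmulr_rge0 (x := ((N.*2.+1 ^ size s * 2 ^ (C * (N * size s).+1 ^ k))%N)%:R)).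
    by apply: le_trans low; rewrite exprn_ge0 // decay_ge0.
  by rewrite ltr0n muln_gt0 !expn_gt0.
apply: le_trans lower; rewrite ler_expR lerN2.
rewrite natrM powRM ?ler0n // -/b -xk; apply: ler_wpM2r; first by rewrite exprn_ge0 // ltW.
rewrite natrX -powR_mulrn ?ler0n // -powRrM -{1}[K%:R]powRr1 ?ler0n //.
apply: ler_powR; first by rewrite ler1n.
rewrite /b mulrA ler_pdivlMr // mul1r -natrM ler_nat; lia.
Qed.
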